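(* Let $X$ be a complex Banach space and let $A:D(A)\subset X\to X$ be the generator of a strongly continuous quasi-compact analytic semigroup $(e^{tA})_{t\ge 0}$ of bounded linear operators on $X$. Let $B:D(B)\subset X\to X$ be a linear operator such that: (1) $B$ is $\theta$-subordinate to $A$ for some $0\le\theta<1$; (2) for every $t>0$, the operator $Be^{tA}$ is compact on $X$. Assume that $A+B$ generates a strongly continuous semigroup $(e^{t(A+B)})_{t\ge0}$ on $X$. Then the semigroup $(e^{t(A+B)})_{t\ge 0}$ is quasi-compact.
   Context: A linear operator $B:D(B)\to X$ is $\theta$-subordinate to $A$ (with $0\le\theta<1$) if $D(A)\subseteq D(B)$ and there is a constant $c>0$ such that $\|Bx\|\le c\,\|Ax\|^{\theta}\|x\|^{1-\theta}$ for all $x\in D(A)$ (for $\theta=0$ this reads $\|Bx\|\le c\|x\|$). The operator $A+B$ has domain $D(A+B)=D(A)$. A $C_0$-semigroup $(T(t))_{t\ge0}$ on $X$ is quasi-compact if $\lim_{t\to\infty}\inf\{\|T(t)-K\|_{\mathcal L(X)} : K\in\mathcal L(X),\ K \text{ compact}\}=0$. *)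

(* Defs.v *)
From HB Require Import structures.
From mathcomp Require Import all_boot all_order all_algebra.
From mathcomp Require Import complex.
From mathcomp Require Import all_classical all_reals all_analysis.
Set Implicit Arguments.
Unset Strict Implicit.
Unset Printing Implicit Defensive.
Import Order.TTheory GRing.Theory Num.Theory numFieldNormedType.Exports.
Local Open Scope classical_set_scope.
Local Open Scope ring_scope.
Local Open Scope complex_scope.

(* The norm of a normed module over R[i] takes its (real, nonnegative) values
   in R[i]; [nrm] is the same norm with values in R. *)
Definition nrm (R : realType) (X : normedModType R[i]) (x : X) : R :=
  complex.Re `|x|.

Definition bounded_op (R : realType) (X : normedModType R[i]) (T : X -> X) :=
  linear T /\ continuous T.

Definition opnorm (R : realType) (X : normedModType R[i]) (T : X -> X)
    : \bar R :=
  ereal_sup [set (nrm (T x))%:E | x in [set x : X | nrm x <= 1]].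

Definition compact_op (R : realType) (X : normedModType R[i]) (K : X -> X) :=
  bounded_op K /\ precompact (K @` [set x : X | nrm x <= 1]).

(* An operator D(A) -> X is a total map together with the set [dom A] on which
   it is to be considered; values outside [dom A] are irrelevant. *)
Record operator (R : realType) (X : normedModType R[i]) := Operator {
  dom : set X;
  op :> X -> X
}.

Definition linear_operator (R : realType) (X : normedModType R[i])
    (A : operator X) :=
  dom A 0 /\
  forall (a : R[i]) (x y : X), dom A x -> dom A y ->
    dom A (a *: x + y) /\ A (a *: x + y) = a *: A x + A y.

(* The perturbed operator A + B, on the domain of A *)
Definition perturb (R : realType) (X : normedModType R[i])
    (A B : operator X) : operator X :=
  Operator (dom A) (fun x => A x + B x).

(* Since 0 `^ 0 = 1, for theta = 0 the bound reads |B x| <= c |x|. *)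
Definition subordinate (R : realType) (X : normedModType R[i]) (theta : R)
    (B A : operator X) :=
  dom A `<=` dom B /\
  exists2 c : R, 0 < c &
    forall x, dom A x ->
      nrm (B x) <= c * nrm (A x) `^ theta * nrm x `^ (1 - theta).

(* Semigroups are indexed by R; only the times t >= 0 are meaningful. *)
Definition C0_semigroup (R : realType) (X : normedModType R[i])
    (T : R -> X -> X) :=
  [/\ forall t : R, 0 <= t -> bounded_op (T t),
      forall x, T 0 x = x,
      forall s t : R, 0 <= s -> 0 <= t -> forall x, T (s + t) x = T s (T t x) &
      forall x, T t x @[t --> 0^'+] --> x].

(* The graph of A is that of the right derivative of the orbits at 0; in
   particular [dom A] is the set of all x for which this derivative exists. *)
Definition generates (R : realType) (X : normedModType R[i])
    (A : operator X) (T : R -> X -> X) :=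
  C0_semigroup T /\
  forall x y,
    (dom A x /\ A x = y) <->
    ((h^-1)%:C *: (T h x - x) @[h --> 0^'+] --> y).

(* { z != 0 : |arg z| < delta } *)
Definition sector (R : realType) (delta : R) : set R[i] :=
  [set z | exists r phi : R,
     [/\ 0 < r, `|phi| < delta & z = (r * cos phi) +i* (r * sin phi)]].

(* Complex differentiability at z with respect to the operator norm *)
Definition op_holomorphic_at (R : realType) (X : normedModType R[i])
    (T : R[i] -> X -> X) (z : R[i]) :=
  exists2 D : X -> X, bounded_op D &
    opnorm (fun x => h^-1 *: (T (z + h) x - T z x) - D x)
      @[h --> (0 : R[i]^o)^'] --> 0%E.

(* T extends to an analytic semigroup on some sector, strongly continuous at 0
   on every strictly smaller sector. *)
Definition analytic_semigroup (R : realType) (X : normedModType R[i])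
    (T : R -> X -> X) :=
  exists delta : R, 0 < delta <= pi / 2 /\
  exists2 Tz : R[i] -> X -> X,
    forall t : R, 0 <= t -> forall x, Tz t%:C x = T t x &
    [/\ forall z, sector delta z -> bounded_op (Tz z),
        forall z w, sector delta z -> sector delta w ->
          forall x, Tz (z + w) x = Tz z (Tz w x),
        forall z, sector delta z -> op_holomorphic_at Tz z &
        forall delta' : R, 0 < delta' < delta -> forall x,
          Tz z x @[z --> within (sector delta') (nbhs (0 : R[i]^o))] --> x].

Definition quasi_compact (R : realType) (X : normedModType R[i])
    (T : R -> X -> X) :=
  ereal_inf [set opnorm (fun x => T t x - K x) | K in @compact_op R X]
    @[t --> +oo] --> 0%E.

(* Main.v *)
Require Import Defs.
From HB Require Import structures.
From mathcomp Require Import all_boot all_order all_algebra.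
From mathcomp Require Import complex.
From mathcomp Require Import all_classical all_reals all_analysis.
From mathcomp Require Import ring lra.
Set Implicit Arguments.
Unset Strict Implicit.
Unset Printing Implicit Defensive.
Import Order.TTheory GRing.Theory Num.Theory numFieldNormedType.Exports.
Local Open Scope classical_set_scope.
Local Open Scope ring_scope.
Local Open Scope complex_scope.

(** For [t > 0] the path [s |-> S (t - s) (T s x)] leads from [S t x] to [T t x],
    and its derivative at [s] is [- S (t - s) (B (T s x))]. So [S t - T t] is the
    integral over [s] of the compact operators [S (t - s) (B (T s))], and this
    makes it compact ([semigroup_difference_compact]). It follows that [S t] and
    [T t] have the same distance to the compact operators, and quasi-compactness
    passes from [T] to [S].

    Two points need care in this integral. The first is the singularity at
    [s = 0]: analyticity gives a bound [C / s] for the norm of [A (T s)]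
    ([analytic_generator_bound]), so by subordination [B (T s)] is bounded by a
    multiple of [s `^ (- theta)], which is integrable; a neighbourhood of 0
    contributes arbitrarily little in norm ([duhamel_near0]). The second is that
    away from 0 the Riemann sums must converge in operator norm. This holds because
    the integrand is norm continuous ([perturbation_norm_continuous]): [T] is norm
    continuous at positive times, and [S], which is only strongly continuous, acts
    on the totally bounded image of the unit ball under [B (T s)].

    The integral itself never appears. The mean value inequality
    [mean_value_growth], proved by real induction, compares increments of the path
    with increments of a majorant near 0 ([duhamel_near0]) and with multiples of a
    single compact operator elsewhere ([duhamel_increment], [duhamel_compact]).
    Likewise the bound [C / s] rests on a Cauchy estimate for vector-valued
    functions, in which averages over the [n]-th roots of unity replace the contour
    integral ([cauchy_estimate]). *)

(** * The real-valued norm *)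

Definition cmod (R : realType) (z : R[i]) : R := complex.Re `|z|.

Section NormCalculus.
Variables (R : realType) (X : normedModType R[i]).
Implicit Types (x y : X) (a : R[i]) (r : R).

Lemma nrm_ge0 x : 0 <= nrm x.
Proof. by have := normr_ge0 x; rewrite lecE => /andP[_]. Qed.

Lemma normE x : `|x| = (nrm x)%:C.
Proof. by rewrite /nrm RRe_real// ger0_real. Qed.

Lemma nrmD x y : nrm (x + y) <= nrm x + nrm y.
Proof. by have := ler_normD x y; rewrite !normE -rmorphD lecR. Qed.

Lemma nrmN x : nrm (- x) = nrm x.
Proof. by rewrite /nrm normrN. Qed.

Lemma nrmC x y : nrm (x - y) = nrm (y - x).
Proof. by rewrite -nrmN opprB. Qed.

Lemma nrm0 : nrm (0 : X) = 0.
Proof. by rewrite /nrm normr0. Qed.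

Lemma nrm0_eq0 x : nrm x = 0 -> x = 0.
Proof. by move=> x0; apply: normr0_eq0; rewrite normE x0. Qed.

Lemma nrm_tri x y z : nrm (x - z) <= nrm (x - y) + nrm (y - z).
Proof. by apply: le_trans (nrmD _ _); rewrite addrA subrK. Qed.

Lemma nrmB_ge x y : nrm x - nrm y <= nrm (x - y).
Proof. by rewrite lerBlDr -{1}(subrK y x) nrmD. Qed.

Lemma nrm_sum n (f : 'I_n -> X) : nrm (\sum_(i < n) f i) <= \sum_(i < n) nrm (f i).
Proof.
elim/big_rec2: _ => [|i u v _ uv]; first by rewrite nrm0.
by apply: le_trans (nrmD _ _) _; rewrite lerD2l.
Qed.

Lemma normcE a : `|a| = (cmod a)%:C.
Proof. by rewrite /cmod RRe_real// ger0_real. Qed.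

Lemma cmod_ge0 a : 0 <= cmod a.
Proof. by have := normr_ge0 a; rewrite lecE => /andP[_]. Qed.

Lemma cmodM a b : cmod (a * b) = cmod a * cmod b.
Proof. by rewrite {1}/cmod normrM !normcE -rmorphM. Qed.

Lemma cmodD a b : cmod (a + b) <= cmod a + cmod b.
Proof. by have := ler_normD a b; rewrite !normcE -rmorphD lecR. Qed.

Lemma cmod_real r : cmod r%:C = `|r|.
Proof. by rewrite /cmod normc_def /= expr0n addr0 sqrtr_sqr. Qed.

Lemma cmod_nat n : cmod (n%:R : R[i]) = n%:R.
Proof.
by rewrite -(rmorph_nat (real_complex R) n) cmod_real ger0_norm.
Qed.

Lemma cmod0 : cmod (0 : R[i]) = 0.
Proof. by rewrite /cmod normr0. Qed.

Lemma cmod1 : cmod (1 : R[i]) = 1.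
Proof. by rewrite /cmod normr1. Qed.

Lemma cmodX a n : cmod (a ^+ n) = cmod a ^+ n.
Proof. by elim: n => [|n ih]; rewrite ?expr0 ?cmod1// !exprS cmodM ih. Qed.

Lemma cmodV a : cmod a^-1 = (cmod a)^-1.
Proof. by rewrite {1}/cmod normfV normcE -fmorphV. Qed.

Lemma cmod_gt0 a : a != 0 -> 0 < cmod a.
Proof. by rewrite -normr_gt0 normcE ltcE /= eqxx. Qed.

Lemma Re_le_cmod a : `|complex.Re a| <= cmod a.
Proof. by have := normc_ge_Re a; rewrite normcE lecR. Qed.

Lemma Im_le_cmod a : `|complex.Im a| <= cmod a.
Proof.
rewrite /cmod normc_def /= -[leLHS]ger0_norm// -sqrtr_sqr.
by rewrite real_normK ?num_real// ler_wsqrtr// lerDr sqr_ge0.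
Qed.

Lemma nrmZ a x : nrm (a *: x) = cmod a * nrm x.
Proof. by rewrite {1}/nrm normrZ normcE normE -rmorphM. Qed.

Lemma nrmZr r x : nrm (r%:C *: x) = `|r| * nrm x.
Proof. by rewrite nrmZ cmod_real. Qed.

Lemma complex_pos (e : R[i]) : 0 < e -> exists2 d : R, 0 < d & e = d%:C.
Proof.
move=> e0; have eE : e = (complex.Re e)%:C by rewrite RRe_real// gtr0_real.
by exists (complex.Re e) => //; rewrite eE ltcR in e0.
Qed.

Lemma cvg_nrmP (I : Type) (F : set_system I) (FF : Filter F) (f : I -> X) x :
  f @ F --> x <-> forall e : R, 0 < e -> \forall i \near F, nrm (f i - x) <= e.
Proof.
rewrite cvgrPdist_le; split=> [h e e0|h _ /complex_pos[e e0 ->]].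
  by have := h e%:C; rewrite ltcR => /(_ e0); apply: filterS => i; rewrite normE lecR nrmC.
by apply: filterS (h e e0) => i; rewrite normE lecR nrmC.
Qed.

End NormCalculus.

Lemma near_right0P (R : realType) (P : R -> Prop) :
  (\forall h \near 0^'+, P h) <->
  exists2 d : R, 0 < d & forall h, 0 < h < d -> P h.
Proof.
split.
  rewrite /at_right /within /= => /nbhs_ballP[d /= d0 H]; exists d => // h /andP[h0 hd].
  by apply: H => //; rewrite /ball /= sub0r normrN gtr0_norm.
move=> [d d0 H]; rewrite /at_right /within /=; apply/nbhs_ballP; exists d => //= h.
rewrite /ball /= sub0r normrN => hd h0; apply: H; rewrite h0/=.
by rewrite -[h]gtr0_norm.
Qed.

(** * Real induction and the mean value inequality *)

(** Let [c] be the supremum of the points up to which [P] holds throughout. The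
    last hypothesis gives [P c], and if [c < b] the step hypothesis moves past
    [c]. This is the form in which the compactness of an interval is used below. *)
Lemma real_induction (R : realType) (P : R -> Prop) (a b : R) :
  a <= b -> P a ->
  (forall s, a <= s < b -> P s ->
    exists2 d : R, 0 < d & forall r, s < r < s + d -> r <= b -> P r) ->
  (forall s, a < s <= b -> (forall r, a <= r < s -> P r) -> P s) ->
  P b.
Proof.
move=> ab Pa Pstep Plim.
pose E := [set s | a <= s <= b /\ forall r, a <= r <= s -> P r].
have Ea : E a.
  split; first by rewrite lexx.
  by move=> r /andP[ar ra]; rewrite (_ : r = a)//; apply/eqP; rewrite eq_le ar ra.
have supE : has_sup E.
  by split; [exists a | exists b => s [/andP[_ sb] _]].
pose c := sup E.
have ac : a <= c by apply: sup_upper_bound.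
have cb : c <= b by apply: ge_sup; [exists a | move=> s [/andP[]]].
have Pc' r : a <= r < c -> P r.
  move=> /andP[ar rc].
  have [s [_ Es] rs] := sup_gt (ex_intro _ _ Ea) rc.
  by apply: Es; rewrite ar ltW.
have Pc : P c.
  by move: ac; rewrite le_eqVlt => /orP[/eqP <-//|ac]; apply: Plim; rewrite ?ac.
move: cb; rewrite le_eqVlt => /orP[/eqP <-//|cb].
have acb : a <= c < b by rewrite ac.
have [d d0 Pd] := Pstep c acb Pc.
pose c' := Num.min (c + d / 2) b.
have cc' : c < c' by rewrite lt_min cb ltrDl divr_gt0.
suff /(sup_upper_bound supE) : E c' by rewrite leNgt cc'.
split=> [|r /andP[ar rc']]; first by rewrite (le_trans ac (ltW cc')) ge_min lexx orbT.
have [rc|cr] := ltP r c; first by apply: Pc'; rewrite ar.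
move: cr; rewrite le_eqVlt => /orP[/eqP <-//|cr].
move: rc'; rewrite le_min => /andP[rd rb]; apply: Pd => //.
by rewrite cr (le_lt_trans rd)// ltrD2l ltr_pdivrMr// ltr_pMr// ltr1n.
Qed.

Section MeanValue.
Variables (R : realType) (X : normedModType R[i]).
Implicit Types (f : R -> X).

Definition left_continuous f (a b : R) := forall s, a < s <= b ->
  forall e, 0 < e ->
  exists2 d : R, 0 < d & forall r, a <= r < s -> s - d < r -> nrm (f s - f r) <= e.

Definition right_derivative f (s : R) (v : X) := forall e, 0 < e ->
  exists2 d : R, 0 < d & forall h, 0 < h < d ->
    nrm (f (s + h) - f s - h%:C *: v) <= e * h.

(** By real induction, [nrm (f s - f a) <= g s - g a + e * (s - a)] for every
    slack [e > 0]. The growth of [f] is compared with increments of [g], and not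
    with a constant, so that [g] may be a power of [s] whose derivative blows up
    at 0; only right derivatives are involved, since the generator of a semigroup
    is a right derivative. *)
Lemma mean_value_growth f (g : R -> R) a b : a <= b -> left_continuous f a b ->
  (forall r s, a <= r -> r <= s -> s <= b -> g r <= g s) ->
  (forall s, a <= s < b -> forall e, 0 < e -> exists2 d : R, 0 < d &
     forall h, 0 < h < d -> nrm (f (s + h) - f s) <= g (s + h) - g s + e * h) ->
  nrm (f b - f a) <= g b - g a.
Proof.
move=> ab fcont gmono growth; apply/ler_addgt0Pr => e' e'0.
pose e := e' / (b - a + 1).
have e0 : 0 < e by rewrite divr_gt0//; lra.
suff : nrm (f b - f a) <= g b - g a + e * (b - a).
  move/le_trans; apply; rewrite lerD2l /e -mulrA ger_pMr// mulrC ler_pdivrMr; lra.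
apply: (@real_induction _ (fun s => nrm (f s - f a) <= g s - g a + e * (s - a)) a b).
- exact: ab.
- by rewrite !subrr nrm0; lra.
- move=> s sab Ps; have [d d0 H] := growth s sab e e0.
  exists d => // r /andP[sr rd] _.
  have := H (r - s); rewrite (addrC s) subrK => /(_ _).
  have -> : 0 < r - s < d by lra.
  move=> /(_ isT) => Hr; apply: le_trans (nrm_tri _ (f s) _) _; lra.
move=> s /andP[sa sb] Pr; apply/ler_addgt0Pr => eta eta0.
have asb : a < s <= b by rewrite sa.
have [d d0 H] := fcont s asb eta eta0.
pose r := Num.max a (s - d / 2).
have ar : a <= r by rewrite le_max lexx.
have rs : r < s by rewrite gt_max sa/=; lra.
have rd : s - d < r by rewrite lt_max; apply/orP; right; lra.
have /H/(_ rd) H1 : a <= r < s by rewrite ar.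
have /Pr H2 : a <= r < s by rewrite ar.
have g1 := gmono r s ar (ltW rs) sb.
have er : e * (r - a) <= e * (s - a) by rewrite ler_pM2l//; lra.
apply: le_trans (nrm_tri _ (f r) _) _; lra.
Qed.

Lemma mean_value_bound f (f' : R -> X) (C : R) a b : a <= b ->
  left_continuous f a b ->
  (forall s, a <= s < b -> right_derivative f s (f' s) /\ nrm (f' s) <= C) ->
  nrm (f b - f a) <= C * (b - a).
Proof.
move=> ab fcont df.
have [abE|altb] := leP b a.
  have -> : b = a by apply/eqP; rewrite eq_le abE.
  by rewrite !subrr nrm0 mulr0.
have C0 : 0 <= C.
  by have [_] := df a (introT andP (conj (lexx a) altb)); apply/le_trans/nrm_ge0.
rewrite mulrBr; apply: (mean_value_growth (g := fun s => C * s)) => //.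
  by move=> r s _ rs _; rewrite ler_wpM2l.
move=> s sab e e0; have [ds Cs] := df s sab; have [d d0 H] := ds e e0.
exists d => // h hd; have := H h hd.
have : `|h| * nrm (f' s) <= h * C by case/andP: hd => h0 _; rewrite gtr0_norm// ler_pM2l.
rewrite -nrmZr => h1 h2; rewrite -(subrK (h%:C *: f' s) (f (s + h) - f s)).
by apply: le_trans (nrmD _ _) _; lra.
Qed.

Definition real_derivative f (s : R) (v : X) := forall e, 0 < e ->
  exists2 d : R, 0 < d & forall h, `|h| < d ->
    nrm (f (s + h) - f s - h%:C *: v) <= e * `|h|.

Lemma real_derivative_right f s v : real_derivative f s v -> right_derivative f s v.
Proof.
move=> df e e0; have [d d0 H] := df e e0; exists d => // h /andP[h0 hd].
by have := H h; rewrite gtr0_norm// => /(_ hd).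
Qed.

Lemma real_derivative_left_continuous f f' (a b : R) :
  (forall s, a < s <= b -> real_derivative f s (f' s)) -> left_continuous f a b.
Proof.
move=> df s sab e e0; have [d d0 H] := df s sab 1 ltr01.
pose c := e / (1 + nrm (f' s)).
have n0 := nrm_ge0 (f' s).
have c0 : 0 < c by rewrite divr_gt0//; lra.
exists (Num.min d c) => [|r /andP[ar rs] rd]; first by rewrite lt_min d0.
have : s - r < Num.min d c by lra.
rewrite lt_min => /andP[rd' rc].
have := H (r - s); rewrite distrC gtr0_norm ?subr_gt0// => /(_ rd').
rewrite (addrC s) subrK mul1r => h1.
have h2 : (s - r) * (1 + nrm (f' s)) <= e.
  by rewrite -ler_pdivlMr ?ltW//; lra.
rewrite nrmC -(subrK ((r - s)%:C *: f' s) (f r - f s)).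
apply: le_trans (nrmD _ _) _; rewrite nrmZr distrC gtr0_norm ?subr_gt0//; lra.
Qed.

(** Version for functions with a two-sided derivative, whose left continuity
    comes for free. *)
Lemma mean_value_inequality f f' (C : R) a b : a <= b ->
  (forall s, a <= s <= b -> real_derivative f s (f' s) /\ nrm (f' s) <= C) ->
  nrm (f b - f a) <= C * (b - a).
Proof.
move=> ab df; apply: (mean_value_bound (f' := f')) => //.
  apply: (@real_derivative_left_continuous f f') => s /andP[sa sb].
  by apply: (df s _).1; rewrite ltW.
move=> s /andP[sa sb]; have sab : a <= s <= b by rewrite sa ltW.
by have [ds fs] := df s sab; split=> //; exact: real_derivative_right.
Qed.

Lemma real_derivativeD f g s (u v : X) : real_derivative f s u ->
  real_derivative g s v -> real_derivative (fun r => f r + g r) s (u + v).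
Proof.
move=> df dg e e0; have e2 : 0 < e / 2 by lra.
have [d1 d10 H1] := df _ e2; have [d2 d20 H2] := dg _ e2.
exists (Num.min d1 d2) => [|h]; first by rewrite lt_min d10.
rewrite lt_min => /andP[/H1 ? /H2 ?].
rewrite /= scalerDr !opprD (addrACA (f _)) (addrACA (f _ - f _)).
by apply: le_trans (nrmD _ _) _; lra.
Qed.

Lemma real_derivative_cst (w : X) s : real_derivative (fun=> w) s 0.
Proof.
move=> e e0; exists 1 => // h _.
by rewrite subrr scaler0 subrr nrm0 mulr_ge0// ltW.
Qed.

Lemma real_derivative_line (w : X) s : real_derivative (fun r => r%:C *: w) s w.
Proof.
move=> e e0; exists 1 => // h _.
by rewrite rmorphD scalerDl (addrC (s%:C *: w)) addrK subrr nrm0 mulr_ge0// ltW.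
Qed.

Lemma real_derivativeZ f s v (a : R[i]) :
  real_derivative f s v -> real_derivative (fun r => a *: f r) s (a *: v).
Proof.
move=> df e e0; have a0 := cmod_ge0 a.
have c0 : 0 < e / (1 + cmod a) by rewrite divr_gt0//; lra.
have [d d0 H] := df _ c0; exists d => // h /H Hh.
rewrite -scalerBr scalerA mulrC -scalerA -scalerBr nrmZ.
have : cmod a * nrm (f (s + h) - f s - h%:C *: v) <=
       cmod a * (e / (1 + cmod a) * `|h|) by rewrite ler_wpM2l.
move/le_trans; apply; rewrite mulrA ler_wpM2r// mulrCA ger_pMr//.
by rewrite ler_pdivrMr; lra.
Qed.

Lemma real_derivative_sum n (f : 'I_n -> R -> X) s (v : 'I_n -> X) :
  (forall k, real_derivative (f k) s (v k)) ->
  real_derivative (fun r => \sum_(k < n) f k r) s (\sum_(k < n) v k).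
Proof.
elim: n f v => [|n ih] f v df.
  rewrite big_ord0; under eq_fun do rewrite big_ord0.
  exact: real_derivative_cst.
rewrite big_ord_recr; under eq_fun do rewrite big_ord_recr.
exact: real_derivativeD (ih _ _ (fun k => df _)) (df _).
Qed.

End MeanValue.

(** * Uniform boundedness *)

Section UniformBoundedness.
Variables (R : realType) (X : completeNormedModType R[i]).

Lemma linear_opB (f : X -> X) : linear f -> {morph f : x y / x - y}.
Proof.
move=> fl x y; have := fl (-1) y x; rewrite !scaleN1r => fyx.
by rewrite addrC fyx addrC.
Qed.

Lemma linear_opD (f : X -> X) : linear f -> {morph f : x y / x + y}.
Proof. by move=> fl x y; have := fl 1 x y; rewrite !scale1r. Qed.

Lemma linear_op0 (f : X -> X) : linear f -> f 0 = 0.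
Proof. by move=> fl; have := linear_opB fl 0 0; rewrite !subrr. Qed.

Lemma linear_opZ (f : X -> X) : linear f -> forall a, {morph f : x / a *: x}.
Proof. by move=> fl a x; have := fl a x 0; rewrite (linear_op0 fl) !addr0. Qed.

Lemma linear_unit_ball (f : X -> X) (M : R) : linear f ->
  (forall x, nrm x <= 1 -> nrm (f x) <= M) -> forall x, nrm (f x) <= M * nrm x.
Proof.
move=> fl fM x; have [x0|x0] := eqVneq (nrm x) 0.
  by rewrite x0 mulr0 (nrm0_eq0 x0) linear_op0// nrm0.
have xp : 0 < nrm x by rewrite lt_def x0 nrm_ge0.
have := fM ((nrm x)^-1%:C *: x); rewrite linear_opZ// !nrmZr gtr0_norm ?invr_gt0//.
by rewrite mulVf// lexx => /(_ isT); rewrite mulrC ler_pdivrMr.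
Qed.

Lemma bounded_opP (f : X -> X) : linear f ->
  continuous f <-> exists2 M : R, 0 < M & forall x, nrm (f x) <= M * nrm x.
Proof.
move=> fl; split.
  move=> /(_ 0); rewrite /continuous_at linear_op0// => /cvg_nrmP f0.
  have /nbhs_ballP[_ /complex_pos[d d0 ->] H] := f0 1 ltr01.
  exists (2 / d); first by rewrite divr_gt0.
  apply: linear_unit_ball => // x x1; have := H ((d / 2)%:C *: x); rewrite linear_opZ//.
  rewrite subr0 nrmZr gtr0_norm ?divr_gt0// -[2 / d]invf_div => /(_ _).
  have dx : ball 0 d%:C ((d / 2)%:C *: x).
    rewrite -ball_normE /= sub0r normrN normE ltcR nrmZr gtr0_norm ?divr_gt0//.
    have : d / 2 * nrm x <= d / 2 * 1 by rewrite ler_pM2l ?divr_gt0.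
    lra.
  by move=> /(_ dx) ?; rewrite -[leRHS]mul1r ler_pdivlMr ?divr_gt0// mulrC.
move=> [M M0 fM] x; apply/cvg_nrmP => e e0.
apply/nbhs_ballP; exists (e / M)%:C => [|y]; first by rewrite /= ltcR divr_gt0.
rewrite -ball_normE /= normE ltcR nrmC ltr_pdivlMr// mulrC => yx.
by rewrite -linear_opB// (le_trans (fM _))// ltW.
Qed.

Lemma cauchy_nested (x : nat -> X) (d : nat -> R) :
  (forall n, 0 < d n) -> (forall n, d n.+1 <= d n / 2) ->
  (forall n, nrm (x n.+1 - x n) + d n.+1 <= d n) ->
  exists l, forall n, nrm (l - x n) <= d n.
Proof.
move=> d0 dhalf near1.
have nested n m : nrm (x (n + m)%N - x n) + d (n + m)%N <= d n.
  elim: m => [|m ih]; first by rewrite addn0 subrr nrm0 add0r.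
  rewrite addnS; have := near1 (n + m)%N.
  have := nrm_tri (x (n + m).+1) (x (n + m)%N) (x n); lra.
have dgeo n : d n <= d 0%N / 2 ^+ n.
  elim: n => [|n ih]; first by rewrite expr0 divr1.
  by rewrite exprS invfM mulrCA mulrC (le_trans (dhalf n))// ler_wpM2r.
have dsmall (e : R) : 0 < e -> exists n, d n < e.
  move=> e0; exists (Num.truncn (d 0%N / e)); set n := Num.truncn _.
  apply: le_lt_trans (dgeo n) _; rewrite ltr_pdivrMr ?exprn_gt0//.
  rewrite mulrC -ltr_pdivrMr//; apply: lt_le_trans (truncnS_gt _) _.
  by rewrite -natrX ler_nat ltn_expl.
have cx : cvg (x @ \oo).
  apply: cauchy_cvg; apply: cauchy_exP => _ /complex_pos[e e0 ->].
  have [n dn] := dsmall _ e0; exists (x n), n => // m /= nm.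
  rewrite -ball_normE /= normE ltcR nrmC; have := nested n (m - n)%N.
  rewrite subnKC// => H; apply: le_lt_trans dn.
  by apply: le_trans H; rewrite lerDl ltW.
exists (lim (x @ \oo)) => n; apply/ler_addgt0Pr => e e0.
have /cvg_nrmP /(_ e e0)[m _ mP] := cx.
have := mP (n + m)%N (leq_addl _ _) => /= H1.
have := nested n m; have := d0 (n + m)%N.
have := nrm_tri (lim (x @ \oo)) (x (n + m)%N) (x n); rewrite (nrmC (lim _) (x (n + m)%N)); lra.
Qed.

(** If no bound is uniform then, for each [k], every ball contains a smaller one
    on which some [U i] exceeds [k] in norm. Balls nested in this way shrink to a
    point at which the family is unbounded. *)
Lemma uniform_boundedness (I : Type) (U : I -> X -> X) :
  (forall i, bounded_op (U i)) ->
  (forall x, exists C, forall i, nrm (U i x) <= C) ->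
  exists2 M : R, 0 < M & forall i x, nrm (U i x) <= M * nrm x.
Proof.
move=> Ub Ux; apply: contrapT => noM.
have Ul i : linear (U i) by case: (Ub i).
(* [U i] small on a ball would be bounded, as [U i (d y)] is the difference of
   its values at [x + d y] and [x] *)
have big x (d k : R) : 0 < d -> exists i z, nrm (z - x) <= d /\ k < nrm (U i z).
  move=> d0; apply: contrapT => nobig; apply: noM.
  have small i z : nrm (z - x) <= d -> nrm (U i z) <= k.
    by move=> zx; rewrite leNgt; apply/negP => kz; apply: nobig; exists i, z.
  pose M := `|k| * 2 / d + 1; have k0 := normr_ge0 k.
  have M0 : 0 <= `|k| * 2 / d by rewrite divr_ge0 ?mulr_ge0// ltW.
  exists M; first by rewrite /M; lra.
  move=> i; apply: linear_unit_ball => // y y1.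
  have H1 : nrm (U i (d%:C *: y)) <= `|k| * 2.
    rewrite -(addKr x (d%:C *: y)) [- x + _]addrC linear_opB//.
    have := small i (x + d%:C *: y); have := small i x; rewrite subrr nrm0 ltW//.
    rewrite [x + _]addrC addrK nrmZr gtr0_norm//.
    have -> : d * nrm y <= d by rewrite ger_pMr.
    move=> /(_ isT) h1 /(_ isT) h2; apply: le_trans (nrmD _ _) _; rewrite nrmN.
    have := ler_norm k; lra.
  move: H1; rewrite linear_opZ// nrmZr gtr0_norm// -ler_pdivlMl// mulrC /M; lra.
(* balls are encoded as pairs (centre, radius); [good k p q] says that [q] is the
   next ball inside [p] *)
pose good (k : nat) (p q : X * R) :=
  0 < q.2 /\ q.2 <= p.2 / 2 /\ nrm (q.1 - p.1) + q.2 <= p.2 /\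
  exists i, forall z, nrm (z - q.1) <= q.2 -> k%:R < nrm (U i z).
have step (kp : nat * (X * R)) : exists q, 0 < kp.2.2 -> good kp.1 kp.2 q.
  case: kp => k [x d] /=; have [d0|d0] := ltP 0 d; last by exists (x, d).
  have d2 : 0 < d / 2 by lra.
  have [i [z [zx kz]]] := big x (d / 2) (k%:R + 1) d2.
  have [M M0 UM] := (bounded_opP (Ul i)).1 (Ub i).2.
  exists (z, Num.min (d / 2) M^-1) => _.
  have m1 : Num.min (d / 2) M^-1 <= d / 2 by rewrite ge_min lexx.
  have m2 : Num.min (d / 2) M^-1 <= M^-1 by rewrite ge_min lexx orbT.
  split; first by rewrite lt_min d2 invr_gt0.
  split => //; split; first by rewrite /=; lra.
  exists i => y /= yz.
  have H : nrm (U i (z - y)) <= 1.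
    by rewrite (le_trans (UM _))// mulrC -ler_pdivlMr// mul1r nrmC (le_trans yz).
  move: H; rewrite linear_opB//; have := nrmB_ge (U i z) (U i y); lra.
have [F FP] := choice step.
pose fix s n := if n is m.+1 then F (m, s m) else ((0 : X), (1 : R)).
have s0 n : 0 < (s n).2.
  by elim: n => [|n ih] /=; [exact: ltr01 | have [] := FP (n, s n) ih].
have sgood n : good n (s n) (s n.+1) by exact: (FP (n, s n) (s0 n)).
have [l lP] : exists l, forall n, nrm (l - (s n).1) <= (s n).2.
  by apply: cauchy_nested => // n; have [_ [? [? _]]] := sgood n.
have [C CP] := Ux l.
have [_ [_ [_ [i iP]]]] := sgood (Num.truncn C).+1.
have := iP l (lP _); apply/negP; rewrite -leNgt (le_trans (CP i))//.
by rewrite ltW// truncnS_gt.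
Qed.

End UniformBoundedness.

(** * The Cauchy estimate *)

Lemma fine_root_of_unity (R : realType) (d : R) : 0 < d ->
  exists n (w : R[i]),
    [/\ (0 < n)%N, w ^+ n = 1, cmod w = 1, w != 1 & cmod (w - 1) < d].
Proof.
move=> d0.
have near0 (f : R -> R) : {for 0, continuous f} -> \forall x \near 0, `|f x - f 0| < d / 2.
  move=> cf; have d2 : 0 < d / 2 by lra.
  by have /cvgrPdist_lt/(_ _ d2) := cf; apply: filterS => x; rewrite distrC.
have : \forall x \near (0 : R), `|cos x - 1| < d / 2 /\ `|sin x| < d / 2.
  have := near0 _ (@continuous_sin R 0); have := near0 _ (@continuous_cos R 0).
  rewrite cos0 sin0; apply: filterS2 => x; rewrite subr0; exact: conj.
move=> /nbhs_ballP[e /= e0 He].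
have pi0 : 0 < pi :> R by exact: pi_gt0.
(* [n >= 3] puts the angle in ]0, pi[, where the sine does not vanish *)
pose n := (Num.truncn (pi *+ 2 / e)).+3; pose x : R := pi *+ 2 / n%:R.
have n0 : 0 < n%:R :> R by rewrite ltr0n.
have x0 : 0 < x by rewrite divr_gt0// mulr2n addr_gt0.
have xpi : x < pi.
  by rewrite ltr_pdivrMr// -(mulr_natr pi 2) ltr_pM2l// ltr_nat.
have xe : x < e.
  rewrite ltr_pdivrMr// mulrC -ltr_pdivrMr//; apply: lt_le_trans (truncnS_gt _) _.
  by rewrite ler_nat; apply/leqW/leqnSn.
have [cosx sinx] : `|cos x - 1| < d / 2 /\ `|sin x| < d / 2.
  by apply: He; rewrite /ball /= sub0r normrN gtr0_norm.
pose w : R[i] := cos x +i* sin x; exists n, w.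
have wX k : w ^+ k = cos (x *+ k) +i* sin (x *+ k).
  elim: k => [|k ih]; first by rewrite expr0 !mulr0n cos0 sin0.
  rewrite exprS ih !mulrS cosD sinD /w; simpc; congr (_ +i* _); ring.
have cmodE (a b : R) : cmod (a +i* b) = Num.sqrt (a ^+ 2 + b ^+ 2).
  by rewrite /cmod normc_def.
split.
- by [].
- rewrite wX -mulr_natr divfK ?gt_eqF// cos2pi sin2pi. by [].
- by rewrite cmodE cos2Dsin2 sqrtr1.
- have s0 : 0 < sin x by apply: sin_gt0_pi; rewrite x0.
  by apply/eqP => /(congr1 (@complex.Im R)) /= E; move: s0; rewrite E ltxx.
- rewrite (_ : w - 1 = (cos x - 1)%:C + (sin x)%:C * 'i%C); last first.
    by rewrite /w; simpc.
  apply: le_lt_trans (cmodD _ _) _; rewrite cmodM !cmod_real.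
  rewrite (_ : cmod 'i%C = 1); first by lra.
  by rewrite cmodE expr0n/= expr1n add0r sqrtr1.
Qed.

Section CauchyEstimate.
Variables (R : realType) (X : normedModType R[i]).
Implicit Types (u : R[i] -> X) (z w h : R[i]).

Definition complex_derivative u z (v : X) := forall e : R, 0 < e ->
  exists2 d : R, 0 < d & forall h, cmod h < d ->
    nrm (u (z + h) - u z - h *: v) <= e * cmod h.

Lemma complex_derivative_line u z w (s : R) v :
  complex_derivative u (z + s%:C * w) v ->
  real_derivative (fun r => u (z + r%:C * w)) s (w *: v).
Proof.
move=> du e e0; have w0 := cmod_ge0 w.
have c0 : 0 < 1 + cmod w by lra.
have [d d0 H] := du (e / (1 + cmod w)) (divr_gt0 e0 c0).
exists (d / (1 + cmod w)) => [|h hd]; first exact: divr_gt0.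
have hw : cmod (h%:C * w) <= `|h| * (1 + cmod w).
  by rewrite cmodM cmod_real ler_wpM2l//; lra.
have := H (h%:C * w); rewrite rmorphD mulrDl addrA scalerA => H1.
apply: le_trans (H1 _) _.
  by apply: le_lt_trans hw _; rewrite -ltr_pdivlMr.
have := ler_wpM2l (ltW (divr_gt0 e0 c0)) hw.
by move/le_trans; apply; rewrite mulrCA divfK ?gt_eqF// mulrC.
Qed.

Variables (u0 u1 u2 u3 : R[i] -> X) (r M L : R).
Hypothesis r0 : 0 < r.
Hypothesis du0 : forall z, cmod z <= r -> complex_derivative u0 z (u1 z).
Hypothesis du1 : forall z, cmod z <= r -> complex_derivative u1 z (u2 z).
Hypothesis du2 : forall z, cmod z <= r -> complex_derivative u2 z (u3 z).
Hypothesis u0M : forall z, cmod z <= r -> nrm (u0 z) <= M.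
Hypothesis u3L : forall z, cmod z <= r -> nrm (u3 z) <= L.

Let L0 : 0 <= L.
Proof. by apply: le_trans (nrm_ge0 _) (u3L (z := 0) _); rewrite cmod0 ltW. Qed.

Let disc_convex z z' (s : R) : cmod z <= r -> cmod z' <= r -> 0 <= s <= 1 ->
  cmod (z + s%:C * (z' - z)) <= r.
Proof.
move=> zr zr' /andP[s0 s1].
have -> : z + s%:C * (z' - z) = (1 - s)%:C * z + s%:C * z'.
  by rewrite rmorphB /=; ring.
apply: le_trans (cmodD _ _) _; rewrite !cmodM !cmod_real.
have s1' : 0 <= 1 - s by lra.
rewrite (ger0_norm s0) (ger0_norm s1').
have := ler_wpM2l s0 zr'; have := ler_wpM2l s1' zr; lra.
Qed.

(** The next two estimates make [u1] differentiable uniformly on the disc. The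
    factor [L] is absorbed by the mesh of the roots of unity, which tends to 0. *)
Let u2_lipschitz z z' : cmod z <= r -> cmod z' <= r ->
  nrm (u2 z' - u2 z) <= L * cmod (z' - z).
Proof.
move=> zr zr'; pose f (s : R) := u2 (z + s%:C * (z' - z)).
have := @mean_value_inequality _ _ f (fun s => (z' - z) *: u3 (z + s%:C * (z' - z)))
  (L * cmod (z' - z)) 0 1 ler01.
rewrite /f mul1r mul0r addr0 subr0 mulr1 [z + _]addrC subrK; apply => s s01; split.
  by apply: complex_derivative_line; apply/du2/disc_convex.
by rewrite nrmZ mulrC ler_wpM2r ?cmod_ge0// u3L// disc_convex.
Qed.

Let u1_taylor z z' : cmod z <= r -> cmod z' <= r ->
  nrm (u1 z' - u1 z - (z' - z) *: u2 z) <= L * cmod (z' - z) ^+ 2.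
Proof.
move=> zr zr'; set k := z' - z.
pose f (s : R) := u1 (z + s%:C * k) + s%:C *: - (k *: u2 z).
have := @mean_value_inequality _ _ f (fun s => k *: u2 (z + s%:C * k) + - (k *: u2 z))
  (L * cmod k ^+ 2) 0 1 ler01.
rewrite /f mul1r mul0r addr0 subr0 mulr1 [z + k]addrC subrK scale0r addr0 scale1r.
rewrite addrAC; apply => s s01; split.
  apply: real_derivativeD; last exact: real_derivative_line.
  by apply: complex_derivative_line; apply/du1/disc_convex.
rewrite -scalerBr nrmZ expr2 mulrCA ler_wpM2l ?cmod_ge0//.
apply: le_trans (u2_lipschitz _ (disc_convex _ _ s01)) _ => //.
rewrite addrC addKr cmodM cmod_real ler_wpM2l// ler_piMl ?cmod_ge0//.
by case/andP: s01 => s0 s1; rewrite ger0_norm.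
Qed.

Let circle n w (rho : R) : cmod w = 1 -> 0 <= rho <= r ->
  cmod (rho%:C * w ^+ n) <= r.
Proof.
by move=> w1 /andP[rho0 rhor]; rewrite cmodM cmod_real cmodX w1 expr1n mulr1 ger0_norm.
Qed.

(** The sum is, up to the factor [rho * (w - 1)], a Riemann sum of the integral of
    the derivative of [u1] along a circle. The increments of [u1] along the points
    [rho * w ^+ k] add up to 0 because [w ^+ n = 1], so only the Taylor errors
    remain. *)
Let telescope_circle n w (rho : R) : w ^+ n = 1 -> cmod w = 1 -> w != 1 ->
  0 <= rho <= r ->
  nrm (\sum_(k < n) w ^+ k *: u2 (rho%:C * w ^+ k)) <= n%:R * (L * r * cmod (w - 1)).
Proof.
move=> wn w1 wneq1 rhor; have /andP[rho0 rho_r] := rhor.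
have c0 : 0 < cmod (w - 1) by rewrite cmod_gt0// subr_eq0.
have [->|rho_neq0] := eqVneq rho 0.
  under eq_bigr do rewrite mul0r.
  rewrite -scaler_suml (_ : \sum_(k < n) w ^+ k = 0) ?scale0r ?nrm0.
    by rewrite !mulr_ge0 ?cmod_ge0// ltW.
  apply: (@mulfI _ (w - 1)); first by rewrite subr_eq0.
  by rewrite -subrX1 wn subrr mulr0.
have rho_gt0 : 0 < rho by rewrite lt_def rho_neq0.
set S := \sum_(k < n) _.
pose E (k : nat) := u1 (rho%:C * w ^+ k.+1) - u1 (rho%:C * w ^+ k)
   - (rho%:C * w ^+ k.+1 - rho%:C * w ^+ k) *: u2 (rho%:C * w ^+ k).
have sumE : \sum_(k < n) E k = - ((rho%:C * (w - 1)) *: S).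
  rewrite sumrB [X in X - _](_ : _ = 0).
    rewrite sub0r; congr (- _); rewrite scaler_sumr; apply: eq_bigr => k _.
    by rewrite scalerA; congr (_ *: _); rewrite exprS; ring.
  rewrite -(big_mkord xpredT (fun k => u1 (rho%:C * w ^+ k.+1) - u1 (rho%:C * w ^+ k))).
  by rewrite telescope_sumr// wn expr0 subrr.
have normE k : nrm (E k) <= L * (rho * cmod (w - 1)) ^+ 2.
  apply: le_trans (u1_taylor (circle _ w1 rhor) (circle _ w1 rhor)) _.
  rewrite -mulrBr cmodM cmod_real (gtr0_norm rho_gt0).
  rewrite (_ : _ - w ^+ k = (w - 1) * w ^+ k); last by rewrite exprS; ring.
  by rewrite cmodM cmodX w1 expr1n mulr1.
have : rho * cmod (w - 1) * nrm S <= n%:R * (L * (rho * cmod (w - 1)) ^+ 2).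
  rewrite -[leLHS](_ : nrm (\sum_(k < n) E k) = _); last first.
    by rewrite sumE nrmN nrmZ cmodM cmod_real gtr0_norm.
  apply: le_trans (nrm_sum _) _; set C := _ ^+ 2.
  apply: le_trans (_ : \sum_(k < n) L * C <= _); first by apply: ler_sum => k _; exact: normE.
  by rewrite sumr_const card_ord mulr_natl.
rewrite mulrA expr2 mulrA -(mulrC (rho * _)) ler_pM2l ?mulr_gt0// => /le_trans; apply.
rewrite -!mulrA ler_wpM2l// ler_wpM2l//.
by rewrite ler_wpM2r// ltW.
Qed.

(** Average over the [n]-th roots of unity, for a root [w] close to 1. The average
    [m rho] of [u1] over the points [rho * w ^+ k] has a small derivative by
    [telescope_circle], so it stays near [u1 0]. The average [f rho] of
    [w ^- k *: u0 (rho * w ^+ k)] has derivative [m rho], hence [f r - f 0] is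
    near [r *: u1 0], whereas [f] is bounded by [M]. (Both averages are kept
    multiplied by [n].) *)
Lemma cauchy_estimate : r * nrm (u1 0) <= 2 * M.
Proof.
apply/ler_addgt0Pr => e e0.
have Lr0 : 0 <= L * r ^+ 3 by rewrite mulr_ge0// exprn_ge0// ltW.
have c0 : 0 < L * r ^+ 3 + 1 by lra.
have [n [w [n0 wn w1 wneq1 wd]]] := fine_root_of_unity (divr_gt0 e0 c0).
pose eta := L * r * cmod (w - 1).
have eta0 : 0 <= eta by rewrite !mulr_ge0 ?cmod_ge0// ltW.
pose m (s : R) := \sum_(k < n) u1 (s%:C * w ^+ k).
have w_neq0 : w != 0 by apply/eqP => w0; move: w1; rewrite w0 cmod0; lra.
pose f (s : R) := \sum_(k < n) (w ^+ k)^-1 *: u0 (s%:C * w ^+ k).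
have du (u u' : R[i] -> X) (s : R) k :
    (forall z, cmod z <= r -> complex_derivative u z (u' z)) -> 0 <= s <= r ->
    real_derivative (fun s => u (s%:C * w ^+ k)) s (w ^+ k *: u' (s%:C * w ^+ k)).
  move=> duu' sr; have := @complex_derivative_line u 0 (w ^+ k) s (u' (s%:C * w ^+ k)).
  rewrite add0r => /(_ (duu' _ (circle _ w1 sr))).
  by under eq_fun do rewrite add0r.
have m_near s : 0 <= s <= r -> nrm (m s - n%:R *: u1 0) <= n%:R * (eta * r).
  move=> /andP[s0 sr].
  have -> : n%:R *: u1 0 = m 0.
    by rewrite /m; under eq_bigr do rewrite mul0r; rewrite sumr_const card_ord scaler_nat.
  apply: le_trans (_ : n%:R * eta * (s - 0) <= _); last first.
    by rewrite subr0 mulrA ler_wpM2l// mulr_ge0.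
  pose m' (t : R) := \sum_(k < n) w ^+ k *: u2 (t%:C * w ^+ k).
  apply: (mean_value_inequality (f' := m')) => // t /andP[t0 ts].
  have tr : 0 <= t <= r by rewrite t0 (le_trans ts).
  split; last exact: telescope_circle.
  by apply: real_derivative_sum => k; apply: du.
have f_near : nrm (f r - f 0 - r%:C *: (n%:R *: u1 0)) <= n%:R * (eta * r) * r.
  pose g (s : R) := f s + s%:C *: - (n%:R *: u1 0).
  have := @mean_value_inequality _ _ g (fun s => m s + - (n%:R *: u1 0))
    (n%:R * (eta * r)) 0 r (ltW r0).
  rewrite /g scale0r addr0 subr0 scalerN [f r - _ - f 0]addrAC; apply => s sr; split.
    apply: real_derivativeD; last exact: real_derivative_line.
    apply: real_derivative_sum => k.
    rewrite -[u1 _](_ : (w ^+ k)^-1 *: (w ^+ k *: u1 (s%:C * w ^+ k)) = _).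
      exact/real_derivativeZ/du.
    by rewrite scalerA mulVf ?expf_neq0// scale1r.
  exact: m_near.
have fM s : 0 <= s <= r -> nrm (f s) <= n%:R * M.
  move=> sr; apply: le_trans (nrm_sum _) _.
  apply: le_trans (_ : \sum_(k < n) M <= _); last by rewrite sumr_const card_ord mulr_natl.
  apply: ler_sum => k _; rewrite nrmZ cmodV cmodX w1 expr1n invr1 mul1r.
  exact/u0M/circle.
have f0 := fM 0; rewrite lexx ltW// in f0.
have fr := fM r; rewrite lexx ltW// in fr.
have nR : 0 < n%:R :> R by rewrite ltr0n.
rewrite -(ler_pM2l nR) -[leLHS](_ : nrm (r%:C *: (n%:R *: u1 0)) = _); last first.
  by rewrite nrmZr (gtr0_norm r0) nrmZ cmod_nat mulrCA.
have eta_small : eta * r * r <= e.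
  rewrite /eta (_ : _ * r * r = L * r ^+ 3 * cmod (w - 1)); last by ring.
  have : (L * r ^+ 3 + 1) * cmod (w - 1) <= e.
    by rewrite mulrC -ler_pdivlMr// ltW.
  by have := cmod_ge0 (w - 1); lra.
have := nrm_tri (r%:C *: (n%:R *: u1 0)) (f r - f 0) 0; rewrite !subr0 nrmC.
have := nrmD (f r) (- f 0); rewrite nrmN.
have := f0 isT; have := fr isT.
have : n%:R * (eta * r) * r <= n%:R * e by rewrite -mulrA ler_wpM2l// ltW.
lra.
Qed.

End CauchyEstimate.

(** * Compact operators *)

Section TotallyBounded.
Variables (R : realType) (X : normedModType R[i]).
Implicit Types (A B : set X).

Definition totally_bounded A := forall e : R, 0 < e ->
  exists s : seq X, forall x, A x -> exists2 y, y \in s & nrm (x - y) <= e.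

Lemma precompact_totally_bounded A : precompact A -> totally_bounded A.
Proof.
rewrite precompactE compact_cover => cA e e0.
have [||D _ AD] := cA X setT (fun y => ball y e%:C).
- by move=> y _; apply: ball_open; rewrite ltcR.
- by move=> x _; exists x => //; apply: ballxx; rewrite ltcR.
exists (finmap.enum_fset D) => x /(@subset_closure _ A)/AD[y yD].
rewrite -ball_normE /= normE ltcR nrmC => /ltW xy.
by exists y.
Qed.

Lemma totally_boundedD A B : totally_bounded A -> totally_bounded B ->
  totally_bounded [set z | exists x y, [/\ A x, B y & z = x + y]].
Proof.
move=> tA tB e e0; have e2 : 0 < e / 2 by lra.
have [s sP] := tA _ e2; have [t tP] := tB _ e2.
exists [seq x + y | x <- s, y <- t] => _ [x [y [Ax By ->]]].
have [x' x's xx'] := sP _ Ax; have [y' y't yy'] := tP _ By.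
exists (x' + y'); first by apply: allpairs_f.
by rewrite opprD addrACA; apply: le_trans (nrmD _ _) _; lra.
Qed.

Lemma totally_bounded_image A (f : X -> X) (M : R) : totally_bounded A ->
  (forall x y, nrm (f x - f y) <= M * nrm (x - y)) -> totally_bounded (f @` A).
Proof.
move=> tA fM e e0; have M1 : 0 < `|M| + 1 by have := normr_ge0 M; lra.
have [s sP] := tA _ (divr_gt0 e0 M1); exists (map f s) => _ [x Ax <-].
have [y ys xy] := sP x Ax; exists (f y); first exact: map_f.
apply: le_trans (fM x y) _; apply: le_trans (_ : (`|M| + 1) * nrm (x - y) <= _).
  by rewrite ler_wpM2r ?nrm_ge0//; have := ler_norm M; lra.
by rewrite mulrC -ler_pdivlMr.
Qed.

Lemma totally_bounded_approx A : (forall e : R, 0 < e -> exists2 B,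
    totally_bounded B & forall x, A x -> exists2 y, B y & nrm (x - y) <= e) ->
  totally_bounded A.
Proof.
move=> H e e0; have e2 : 0 < e / 2 by lra.
have [B tB AB] := H _ e2; have [s sP] := tB _ e2; exists s => x /AB[y /sP[z zs yz] xy].
by exists z => //; apply: le_trans (nrm_tri _ y _) _; lra.
Qed.

End TotallyBounded.

Lemma ultrafilter_seq (I : eqType) (T : Type) (F : set_system T) (s : seq I) (B : I -> set T) :
  UltraFilter F -> F [set x | exists2 i, i \in s & B i x] -> exists2 i, i \in s & F (B i).
Proof.
move=> FU; elim: s => [|i s ih] Fs.
  suff : F set0 by move/filter_ex => [].
  by apply: filterS Fs => x [].
have [FB|FnB] := in_ultra_setVsetC (B i) FU; first by exists i; rewrite ?mem_head.
have [|j js Fj] := ih; last by exists j; rewrite ?in_cons ?js ?orbT.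
apply: filterS2 FnB Fs => x nB [j]; rewrite in_cons => /orP[/eqP -> //|js Bj].
by exists j.
Qed.

(** An ultrafilter containing the closure of [A] contains one ball around a point
    of each finite net, so it is a Cauchy filter. *)
Lemma totally_bounded_precompact (R : realType) (X : completeNormedModType R[i])
  (A : set X) : totally_bounded A -> precompact A.
Proof.
move=> tA; rewrite precompactE compact_ultra => F FU FA.
have Fc : cauchy F.
  apply: cauchy_exP => _ /complex_pos[e e0 ->].
  have e2 : 0 < e / 3 by lra.
  have [s sP] := tA _ e2.
  have [] := @ultrafilter_seq X X F s (fun y => ball y e%:C) FU; last by move=> y _; exists y.
  apply: filterS FA => x /(_ (ball x (e / 3)%:C)).
  case; first by apply: nbhsx_ballx; rewrite ltcR.
  move=> y [Ay]; rewrite -ball_normE /= normE ltcR => xy.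
  have [z zs yz] := sP y Ay; exists z => //=; rewrite normE ltcR nrmC.
  by apply: le_lt_trans (nrm_tri _ y _) _; lra.
have /cvg_ex[p Fp] : cvg F by apply: cauchy_cvg.
exists p; split=> //.
by apply: (@closed_cvg _ _ F _ id) => //; exact: closed_closure.
Qed.

Section CompactOperators.
Variables (R : realType) (X : completeNormedModType R[i]).
Implicit Types (K L : X -> X).

Let unit_ball : set X := [set x | nrm x <= 1].

Lemma compact_opP K : compact_op K <-> bounded_op K /\ totally_bounded (K @` unit_ball).
Proof.
split=> -[bK cK]; split=> //.
  exact: precompact_totally_bounded.
exact: totally_bounded_precompact.
Qed.

Lemma bounded_opD K L : bounded_op K -> bounded_op L -> bounded_op (fun x => K x + L x).
Proof.
move=> [lK cK] [lL cL]; split=> [a x y|x]; last exact: cvgD (cK x) (cL x).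
by rewrite lK lL scalerDr addrACA.
Qed.

Lemma bounded_op_comp K L : bounded_op K -> bounded_op L -> bounded_op (fun x => K (L x)).
Proof.
move=> [lK cK] [lL cL]; split=> [a x y|x]; first by rewrite lL lK.
exact: continuous_comp (cL x) (cK _).
Qed.

Lemma bounded_op_id : bounded_op (@id X).
Proof. by split=> // x; exact: cvg_id. Qed.

Lemma bounded_op_scale (a : R[i]) : bounded_op (fun x : X => a *: x).
Proof.
split=> [b x y|x]; first by rewrite scalerDr !scalerA mulrC.
exact: scaler_continuous.
Qed.

Lemma compact_opD K L : compact_op K -> compact_op L -> compact_op (fun x => K x + L x).
Proof.
move=> /compact_opP[bK tK] /compact_opP[bL tL]; apply/compact_opP.
split; first exact: bounded_opD.
apply: totally_bounded_approx => e e0; eexists; first exact: totally_boundedD tK tL.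
move=> _ [x x1 <-]; exists (K x + L x); last by rewrite subrr nrm0 ltW.
by exists (K x), (L x); split=> //; exists x.
Qed.

Lemma compact_op_comp K L : bounded_op K -> compact_op L -> compact_op (fun x => K (L x)).
Proof.
move=> bK /compact_opP[bL tL]; apply/compact_opP; split; first exact: bounded_op_comp.
have [M _ KM] := (bounded_opP bK.1).1 bK.2.
rewrite -[X in totally_bounded X](image_comp L K).
by apply: (totally_bounded_image (M := M)) tL _ => x y; rewrite -(linear_opB bK.1).
Qed.

Lemma compact_op_scale (a : R[i]) K : compact_op K -> compact_op (fun x => a *: K x).
Proof. by move=> cK; apply: compact_op_comp cK; exact: bounded_op_scale. Qed.

Lemma compact_op0 : compact_op (fun=> 0 : X).
Proof.
apply/compact_opP; split.
  by split=> [a x y|x]; [rewrite scaler0 addr0 | exact: cvg_cst].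
by move=> e e0; exists [:: 0] => _ [x _ <-]; exists 0; rewrite ?mem_head// subrr nrm0 ltW.
Qed.

Lemma compact_op_limit K : bounded_op K -> (forall e : R, 0 < e ->
    exists2 L, compact_op L & forall x, nrm x <= 1 -> nrm (K x - L x) <= e) ->
  compact_op K.
Proof.
move=> bK KL; apply/compact_opP; split=> //; apply: totally_bounded_approx => e e0.
have [L /compact_opP[_ tL] LP] := KL e e0; eexists; first exact: tL.
by move=> _ [x x1 <-]; exists (L x); [exists x | exact: LP].
Qed.

End CompactOperators.

(** * Strongly continuous semigroups *)

Section Semigroups.
Variables (R : realType) (X : completeNormedModType R[i]).

(** Otherwise there are [U i] of size below [1 / (n + 1)] and norm above [n + 1]
    for each [n]. This sequence converges pointwise to the identity, so it is
    pointwise bounded, against uniform boundedness. Continuous families indexed by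
    a half-line or by a sector are both covered. *)
Lemma bounded_near_identity (I : Type) (P : set I) (size : I -> R) (U : I -> X -> X) :
  (forall i, P i -> bounded_op (U i)) ->
  (forall x, exists2 d : R, 0 < d &
     forall i, P i -> size i < d -> nrm (U i x - x) <= 1) ->
  exists2 d : R, 0 < d & exists2 M : R, 0 < M &
    forall i, P i -> size i < d -> forall x, nrm (U i x) <= M * nrm x.
Proof.
move=> Ub Ux; apply: contrapT => noM.
have bad (n : nat) : exists i, [/\ P i, size i < n.+1%:R^-1 &
    exists x, n.+1%:R * nrm x < nrm (U i x)].
  apply: contrapT => nobad; apply: noM.
  exists n.+1%:R^-1; first by rewrite invr_gt0.
  exists n.+1%:R => // i Pi si x; rewrite leNgt; apply/negP => xi.
  by apply: nobad; exists i; split=> //; exists x.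
have [i iP] := choice bad.
have [||M M0 MP] := @uniform_boundedness R X nat (fun n => U (i n)).
- by move=> n; have [Pi _ _] := iP n; exact: Ub.
- move=> x; have [d d0 dP] := Ux x.
  pose N := Num.truncn d^-1.
  exists (nrm x + 1 + \sum_(n < N.+1) nrm (U (i n) x)) => n.
  have sum0 (p : pred 'I_N.+1) : 0 <= \sum_(n < N.+1 | p n) nrm (U (i n) x).
    by apply: sumr_ge0 => k _; exact: nrm_ge0.
  have x0 := nrm_ge0 x.
  have [nN|Nn] := ltnP n N.+1.
    rewrite (bigD1 (Ordinal nN))//=; have := sum0 (fun k => k != Ordinal nN); lra.
  have [Pi si _] := iP n.
  have : nrm (U (i n) x - x) <= 1.
    apply: dP => //; apply: lt_le_trans si _.
    rewrite -[d]invrK lef_pV2 ?posrE ?invr_gt0 ?ltr0n//.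
    apply: le_trans (ltW (truncnS_gt _)) _; rewrite ler_nat.
    by rewrite (leq_trans Nn).
  have := nrmB_ge (U (i n) x) x; have := sum0 xpredT; lra.
have [_ _ [x xP]] := iP (Num.truncn M).
have := MP (Num.truncn M) x; rewrite leNgt => /negP; apply.
by apply: le_lt_trans xP; rewrite ler_wpM2r ?nrm_ge0// ltW// truncnS_gt.
Qed.

Variable S : R -> X -> X.
Hypothesis S_C0 : C0_semigroup S.

Lemma semigroup_bounded t : 0 <= t -> bounded_op (S t).
Proof. by case: S_C0 => + _ _ _; exact. Qed.

Lemma semigroupD s t x : 0 <= s -> 0 <= t -> S (s + t) x = S s (S t x).
Proof. by case: S_C0 => _ _ + _ => + s0 t0; exact. Qed.

Lemma semigroup_cvg0 x (e : R) : 0 < e ->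
  exists2 d : R, 0 < d & forall h, 0 <= h < d -> nrm (S h x - x) <= e.
Proof.
case: S_C0 => _ S0 _ /(_ x)/cvg_nrmP Sx e0.
have /near_right0P[d d0 H] := Sx e e0; exists d => // h /andP[].
rewrite le_eqVlt => /orP[/eqP <- _|h0 hd]; last by apply: H; rewrite h0.
by rewrite S0 subrr nrm0 ltW.
Qed.

Lemma semigroup_locally_bounded (t : R) :
  exists2 M : R, 1 <= M & forall s, 0 <= s <= t -> forall x, nrm (S s x) <= M * nrm x.
Proof.
have [||d d0 [M M0 MP]] := @bounded_near_identity R [set s | 0 <= s] id S.
- by move=> s; exact: semigroup_bounded.
- move=> x; have [d d0 H] := semigroup_cvg0 x ltr01; exists d => // s /= s0 sd.
  by apply: H; rewrite s0.
pose c := d / 2; have c0 : 0 < c by rewrite /c; lra.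
have cd : c < d by rewrite /c; lra.
pose M1 := M + 1; have M11 : 1 <= M1 by rewrite /M1; lra.
have bound n s : 0 <= s <= n%:R * c -> forall x, nrm (S s x) <= M1 ^+ n.+1 * nrm x.
  elim: n s => [|n ih] s /andP[s0 sn] x.
    rewrite mul0r in sn; apply: le_trans (MP s s0 (le_lt_trans sn d0) x) _.
    by rewrite expr1 ler_wpM2r ?nrm_ge0// /M1; lra.
  have [sc|cs] := leP s c.
    apply: le_trans (MP s s0 (le_lt_trans sc cd) x) _; rewrite ler_wpM2r ?nrm_ge0//.
    apply: le_trans (_ : M1 <= _); first by rewrite /M1; lra.
    by rewrite exprS ler_peMr ?exprn_ege1//; lra.
  have sc0 : 0 <= s - c by lra.
  rewrite -[s](addrNK c) addrC semigroupD ?(ltW c0)//.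
  apply: le_trans (MP c (ltW c0) cd _) _.
  have : nrm (S (s - c) x) <= M1 ^+ n.+1 * nrm x.
    by apply: ih; rewrite sc0/=; move: sn; rewrite -natr1 mulrDl mul1r; lra.
  have := nrm_ge0 (S (s - c) x).
  move=> h0 h1; rewrite [in leRHS]exprS -mulrA; apply: ler_pM => //; first exact: ltW.
  by rewrite /M1; lra.
exists (M1 ^+ (Num.truncn (t / c)).+2); first exact: exprn_ege1.
move=> s /andP[s0 st]; apply: bound; rewrite s0/= (le_trans st)//.
by rewrite -ler_pdivrMr// ltW// truncnS_gt.
Qed.

(** The semigroup law moves the difference of two times to time 0. *)
Lemma semigroup_dist (t M : R) (a b : R) y :
  (forall s, 0 <= s <= t -> forall x, nrm (S s x) <= M * nrm x) ->
  0 <= a <= t -> 0 <= b <= t ->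
  nrm (S a y - S b y) <= M * nrm (S `|a - b| y - y).
Proof.
move=> SM; wlog ba : a b / b <= a => [H|/andP[a0 at_] bt].
  have [|/ltW ab] := leP b a; first exact: H.
  by move=> aT bT; rewrite nrmC distrC; exact: H.
have /andP[b0 _] := bt.
rewrite ger0_norm ?subr_ge0//.
have -> : S a y = S b (S (a - b) y) by rewrite -semigroupD ?subr_ge0// subrKC.
have [Sl _] := semigroup_bounded b0.
by rewrite -(linear_opB Sl); exact: SM.
Qed.

(** A bounded family that converges on a finite net is nearly convergent, with the
    same rate, on the set approximated by this net. *)
Lemma semigroup_cvg0_uniform (A : set X) (e : R) : totally_bounded A -> 0 < e ->
  exists2 d : R, 0 < d & forall h, 0 <= h < d -> forall x, A x -> nrm (S h x - x) <= e.
Proof.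
move=> tA e0; have [M M1 SM] := semigroup_locally_bounded 1.
have c0 : 0 < M + 1 + 1 by lra.
set c := M + 1 + 1 in c0; have ec0 : 0 < e / c by rewrite divr_gt0.
have [s sP] := tA (e / c) ec0.
have [d d0 dP] : exists2 d : R, 0 < d & forall h, 0 <= h < d ->
    forall y, y \in s -> nrm (S h y - y) <= e / c.
  elim: s {sP} => [|y s [d d0 dP]]; first by exists 1.
  have [d' d'0 d'P] := semigroup_cvg0 y ec0.
  exists (Num.min d d') => [|h]; first by rewrite lt_min d0.
  rewrite lt_min => /and3P[h0 hd hd'] z; rewrite in_cons => /orP[/eqP ->|zs].
    by apply: d'P; rewrite h0.
  by apply: dP => //; rewrite h0.
exists (Num.min d 1) => [|h]; first by rewrite lt_min d0 ltr01.
rewrite lt_min => /and3P[h0 hd h1] x /sP[y ys xy].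
have hy : nrm (S h y - y) <= e / c by apply: dP => //; rewrite h0.
have hxy : nrm (S h x - S h y) <= M * (e / c).
  have [Sl _] := semigroup_bounded h0; rewrite -(linear_opB Sl).
  by apply: le_trans (SM h _ _) _; [rewrite h0 ltW | rewrite ler_wpM2l//; lra].
have : nrm (S h x - x) <= (M + 1 + 1) * (e / c).
  apply: le_trans (nrm_tri _ (S h y) _) _.
  have := nrm_tri (S h y) y x; rewrite (nrmC y x); lra.
by rewrite -/c mulrCA divff ?mulr1 ?gt_eqF.
Qed.

End Semigroups.

(** * The generator of an analytic semigroup *)

Definition cone (R : realType) (kappa : R) (z : R[i]) :=
  `|complex.Im z| < kappa * complex.Re z.

Section Cone.
Variable R : realType.
Implicit Types (kappa delta a : R) (z h : R[i]).

Lemma cone_disc kappa a z : 0 < kappa <= 1 -> 0 < a -> cmod z < kappa * a / 2 ->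
  cone kappa (a%:C + z).
Proof.
move=> /andP[k0 k1] a0 za; have := Re_le_cmod z; have := Im_le_cmod z.
case: z za => b c /=; rewrite /cone /= add0r => za cz; rewrite ler_norml => /andP[bz _].
apply: le_lt_trans cz _; have cz0 := cmod_ge0 (b +i* c).
have : kappa * - cmod (b +i* c) <= kappa * b by rewrite ler_pM2l.
have : kappa * cmod (b +i* c) <= cmod (b +i* c) by rewrite ler_piMl.
rewrite mulrDr mulrN; lra.
Qed.

Lemma cone_real kappa a : 0 < kappa -> 0 < a -> cone kappa a%:C.
Proof. by move=> k0 a0; rewrite /cone /= normr0 mulr_gt0. Qed.

(** The argument of [a +i* b] with [a > 0] is the arctangent of [b / a], which is
    small with [b / a]. *)
Lemma cone_sub_sector delta : 0 < delta ->
  exists2 kappa, 0 < kappa <= 1 & forall z, cone kappa z -> sector delta z.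
Proof.
move=> d0; have := @continuous_atan R 0; rewrite /prop_for /continuous_at atan0.
move=> /cvgrPdist_lt/(_ _ d0)/nbhs_ballP[e /= e0 He].
exists (Num.min e 1); first by rewrite lt_min e0 ltr01 ge_min lexx orbT.
move=> [a b]; rewrite /cone /= => ab.
have m0 : 0 < Num.min e 1 by rewrite lt_min e0 ltr01.
have a0 : 0 < a by rewrite -(pmulr_rgt0 _ m0) (le_lt_trans _ ab).
set phi := atan (b / a).
have cphi : 0 < cos phi by apply: cos_gt0_pihalf; rewrite atan_gtNpi2 atan_ltpi2.
exists (a / cos phi), phi; split; first exact: divr_gt0.
  have := He (b / a); rewrite /ball /= !sub0r !normrN normrM normfV (gtr0_norm a0).
  apply; rewrite ltr_pdivrMr//; apply: lt_le_trans ab _.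
  by rewrite ler_pM2r// ge_min lexx.
rewrite divfK ?gt_eqF// mulrAC -mulrA -[sin phi / _]/(tan phi) atanK.
by rewrite mulrC divfK ?gt_eqF.
Qed.

End Cone.

Section OperatorNorm.
Variables (R : realType) (X : normedModType R[i]).

Lemma opnorm_leP (K : X -> X) (e : R) :
  (opnorm K <= e%:E)%E <-> forall x, nrm x <= 1 -> nrm (K x) <= e.
Proof.
split=> [Ke x x1|Ke].
  by rewrite -lee_fin (le_trans _ Ke)//; apply: ereal_sup_ubound; exists x.
by apply: ge_ereal_sup => _ [x x1 <-]; rewrite lee_fin; exact: Ke.
Qed.

Lemma difference_quotientP (f : R -> X) y :
  ((h^-1)%:C *: f h @[h --> 0^'+] --> y) <->
  forall e : R, 0 < e -> exists2 d : R, 0 < d &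
    forall h, 0 < h < d -> nrm (f h - h%:C *: y) <= e * h.
Proof.
have scale (h e : R) : 0 < h ->
    (nrm ((h^-1)%:C *: f h - y) <= e) = (nrm (f h - h%:C *: y) <= e * h).
  move=> h0; have -> : f h - h%:C *: y = h%:C *: ((h^-1)%:C *: f h - y).
    by rewrite scalerBr scalerA -rmorphM divff ?gt_eqF// scale1r.
  by rewrite nrmZr gtr0_norm// mulrC ler_pM2r.
rewrite cvg_nrmP; split=> H e e0.
  have /near_right0P[d d0 dP] := H e e0; exists d => // h hd.
  by rewrite -scale ?dP//; case/andP: hd.
have [d d0 dP] := H e e0; apply/near_right0P; exists d => // h hd.
by rewrite scale ?dP//; case/andP: hd.
Qed.

Lemma op_holomorphicP (T : R[i] -> X -> X) z : op_holomorphic_at T z ->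
  exists2 D, bounded_op D & forall e : R, 0 < e -> exists2 d : R, 0 < d &
    forall h, cmod h < d -> forall x, nrm x <= 1 ->
      nrm (T (z + h) x - T z x - h *: D x) <= e * cmod h.
Proof.
move=> [D bD DP]; exists D => // e e0.
have /DP : nbhs 0%E [set y : \bar R | (y <= e%:E)%E].
  change (nbhs (0 : R) [set r | (r%:E <= e%:E)%E]).
  apply/nbhs_ballP; exists e => //= r; rewrite /ball /= sub0r normrN => re.
  by rewrite lee_fin (le_trans (ler_norm _))// ltW.
rewrite /= /fmap /= /dnbhs /within /= => /nbhs_ballP[_ /complex_pos[d d0 ->] dP].
exists d => // h hd x x1; have [->|h0] := eqVneq h 0.
  by rewrite addr0 subrr scale0r subrr nrm0 cmod0 mulr0.
have := dP h; rewrite /ball /= sub0r normrN normcE ltcR => /(_ hd h0)/opnorm_leP/(_ x x1).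
have -> : T (z + h) x - T z x - h *: D x = h *: (h^-1 *: (T (z + h) x - T z x) - D x).
  by rewrite scalerBr scalerA divff// scale1r.
by rewrite nrmZ mulrC ler_pM2r// cmod_gt0.
Qed.

End OperatorNorm.

Section AnalyticSemigroup.
Variables (R : realType) (X : completeNormedModType R[i]).

(** What the proof needs of analyticity. Cones around the half-line are easier to
    handle than sectors, and complex derivatives [D a] at the points [a] of the
    half-line are enough, see [cone_extension_derivative]. *)
Record cone_extension (T : R -> X -> X) (kappa : R) (Tz : R[i] -> X -> X)
    (D : R -> X -> X) : Prop := ConeExtension {
  ce_kappa : 0 < kappa <= 1;
  ce_real : forall a, 0 < a -> forall x, Tz a%:C x = T a x;
  ce_bounded : forall z, cone kappa z -> bounded_op (Tz z);
  ce_mul : forall z w, cone kappa z -> cone kappa w ->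
    forall x, Tz (z + w) x = Tz z (Tz w x);
  ce_derivative_bounded : forall a, 0 < a -> bounded_op (D a);
  ce_derivative : forall a, 0 < a -> forall e : R, 0 < e ->
    exists2 d : R, 0 < d & forall h, cmod h < d -> forall x,
      nrm (Tz (a%:C + h) x - Tz a%:C x - h *: D a x) <= e * cmod h * nrm x;
  ce_near0 : exists2 d : R, 0 < d & exists2 M : R, 0 < M &
    forall z, cone kappa z -> cmod z < d -> forall x, nrm (Tz z x) <= M * nrm x
}.

Lemma analytic_cone_extension T : analytic_semigroup T ->
  exists kappa Tz D, cone_extension T kappa Tz D.
Proof.
move=> [delta [/andP[delta0 _] [Tz TzT [bTz TzM hTz cTz]]]].
have delta2 : 0 < delta / 2 < delta by apply/andP; split; lra.
have /andP[d20 d2d] := delta2.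
have [kappa k01 ksec2] := cone_sub_sector d20.
have /andP[k0 k1] := k01.
have ksec z : cone kappa z -> sector delta z.
  by move=> /ksec2[r [phi [? phid ?]]]; exists r, phi; split=> //; apply: lt_trans d2d.
pose deriv (a : R) (Da : X -> X) := bounded_op Da /\
    forall e : R, 0 < e -> exists2 d : R, 0 < d &
    forall h, cmod h < d -> forall x, nrm x <= 1 ->
      nrm (Tz (a%:C + h) x - Tz a%:C x - h *: Da x) <= e * cmod h.
have ex_deriv (a : R) : exists Da, 0 < a -> deriv a Da.
  have [a0|_] := ltP 0 a; last by exists id.
  have [Da bDa DaP] := op_holomorphicP (hTz _ (ksec _ (cone_real k0 a0))).
  by exists Da.
have [D DP] := choice ex_deriv.
exists kappa, Tz, D; split => //.
- by move=> a a0 x; rewrite TzT// ltW.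
- by move=> z /ksec; exact: bTz.
- by move=> z w /ksec zs /ksec ws; exact: TzM.
- by move=> a /DP[].
- move=> a a0 e e0; have [[Dl _] /(_ e e0)[d dgt0 dP]] := DP a a0.
  have ka0 : 0 < kappa * a / 2 by rewrite divr_gt0// mulr_gt0.
  exists (Num.min d (kappa * a / 2)) => [|h]; first by rewrite lt_min dgt0.
  rewrite lt_min => /andP[hd hk]; apply: linear_unit_ball; last exact: dP.
  have [l1 _] := bTz _ (ksec _ (cone_disc k01 a0 hk)).
  have [l2 _] := bTz _ (ksec _ (cone_real k0 a0)).
  move=> c x y; rewrite l1 l2 Dl scalerDr !opprD (addrACA (c *: _)).
  by rewrite (addrACA (c *: _ - _)) scalerA mulrC -scalerA !scalerBr.
apply: bounded_near_identity.
  by move=> z /ksec; exact: bTz.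
move=> x; have /cvg_nrmP/(_ 1 ltr01) := cTz _ delta2 x.
rewrite /within /= => /nbhs_ballP[_ /complex_pos[d dgt0 ->] dP].
exists d => // z zk zd; apply: dP; last exact: ksec2.
by rewrite /ball /= sub0r normrN normcE ltcR.
Qed.

Variables (T : R -> X -> X) (kappa : R) (Tz : R[i] -> X -> X) (D : R -> X -> X).
Hypothesis ext : cone_extension T kappa Tz D.

(** The semigroup law gives [Tz (a + b + (z + h)) = Tz (a + h) (Tz (b + z))], in
    which [h] is added to the real point [a] only. Iterating the lemma yields
    derivatives of any order. *)
Lemma cone_extension_derivative (L : X -> X) (a b : R) z x : bounded_op L ->
  0 < a -> cone kappa (b%:C + z) ->
  complex_derivative (fun w => L (Tz ((a + b)%:C + w) x)) z
    (L (D a (Tz (b%:C + z) x))).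
Proof.
move=> [Ll Lc] a0 bz e e0; have [M M0 LM] := (bounded_opP Ll).1 Lc.
set y := Tz (b%:C + z) x; have y0 := nrm_ge0 y.
have y1 : 0 < 1 + nrm y by lra.
have c0 : 0 < M * (1 + nrm y) by rewrite mulr_gt0.
have /andP[k0 k1] := ce_kappa ext.
have [d d0 dP] := ce_derivative ext a0 (divr_gt0 e0 c0).
have ka0 : 0 < kappa * a / 2 by rewrite divr_gt0// mulr_gt0.
exists (Num.min d (kappa * a / 2)) => [|h]; first by rewrite lt_min d0.
rewrite lt_min => /andP[hd hk].
have -> : (a + b)%:C + (z + h) = (a%:C + h) + (b%:C + z) by rewrite rmorphD /=; ring.
have -> : (a + b)%:C + z = a%:C + (b%:C + z) by rewrite rmorphD /=; ring.
rewrite (ce_mul ext (cone_disc (ce_kappa ext) a0 hk) bz) (ce_mul ext (cone_real k0 a0) bz).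
rewrite -/y -(linear_opZ Ll) -!(linear_opB Ll).
apply: le_trans (LM _) _.
have /(_ y) H := dP h hd.
apply: le_trans (_ : M * (e / (M * (1 + nrm y)) * cmod h * nrm y) <= _).
  by rewrite ler_pM2l.
have -> : M * (e / (M * (1 + nrm y)) * cmod h * nrm y) =
    e * cmod h * (nrm y / (1 + nrm y)).
  by field; rewrite !gt_eqF.
apply: ler_piMr; first by rewrite mulr_ge0 ?cmod_ge0// ltW.
by rewrite ler_pdivrMr//; lra.
Qed.

Lemma analytic_derivative (a : R) x : 0 < a ->
  complex_derivative (fun w => Tz (a%:C + w) x) 0 (D (a / 2) (T (a / 2) x)).
Proof.
move=> a0; have a2 : 0 < a / 2 by lra.
have /andP[k0 k1] := ce_kappa ext.
have := @cone_extension_derivative id (a / 2) (a / 2) 0 x.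
rewrite addr0 (ce_real ext a2) -splitr; apply => //; last exact: cone_real.
exact: bounded_op_id.
Qed.

Lemma analytic_generator A : generates A T -> forall (s : R) x, 0 < s ->
  dom A (T s x) /\ A (T s x) = D (s / 2) (T (s / 2) x).
Proof.
move=> [T_C0 gen] s x s0; apply/gen/difference_quotientP => e e0.
have [d d0 dP] := analytic_derivative x s0 e0; exists d => // h /andP[h0 hd].
rewrite -(semigroupD T_C0 _ (ltW h0) (ltW s0)).
have := dP h%:C; rewrite cmod_real gtr0_norm// => /(_ hd).
rewrite !add0r !addr0 -rmorphD !(ce_real ext) ?addr_gt0//.
by rewrite [s + h]addrC.
Qed.

(** The Cauchy estimate for [z |-> Tz (s + z) x] on a disc whose radius is
    proportional to [s], as the cone permits, with the bound of [Tz] near 0. The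
    derivatives of order 1, 2 and 3 are obtained by splitting off [s / 2],
    [s / 4] and [s / 8] from [s]; the third one only has to be finite on the
    disc. *)
Lemma analytic_generator_bound A : generates A T ->
  exists2 s0 : R, 0 < s0 & exists2 C : R, 0 < C &
    forall s : R, 0 < s <= s0 -> forall x, nrm x <= 1 -> nrm (A (T s x)) <= C / s.
Proof.
move=> genA; have /andP[k0 k1] := ce_kappa ext.
have [d d0 [M M0 MP]] := ce_near0 ext.
(* [s <= d / 4] and [cmod z <= s] imply [cmod (s + z) < d] *)
exists (d / 4); first by lra.
exists (64 * M / kappa); first by rewrite divr_gt0// mulr_gt0.
move=> s /andP[s0 sd] x x1.
have s2 : 0 < s / 2 by lra.
have s4 : 0 < s / 4 by lra.
have s8 : 0 < s / 8 by lra.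
have [_ ->] := analytic_generator genA x s0.
(* small enough for the disc of radius [r] around [s / 8] to lie in the cone *)
pose r := kappa * s / 32.
have r0 : 0 < r by rewrite divr_gt0// mulr_gt0.
have in_cone z (b : R) : s / 8 <= b -> cmod z <= r -> cone kappa (b%:C + z).
  move=> sb zr; apply: cone_disc (ce_kappa ext) _ _; first by lra.
  apply: le_lt_trans zr _; rewrite /r.
  have := ler_wpM2l (ltW k0) sb; have := mulr_gt0 k0 s0; lra.
have bD (a : R) : 0 < a -> bounded_op (D a) by exact: (ce_derivative_bounded ext).
have bound (a : R) : 0 < a -> exists2 C : R, 0 < C & forall y, nrm (D a y) <= C * nrm y.
  by move=> /bD[Dl Dc]; exact/(bounded_opP Dl).1.
have [C2 C20 D2] := bound _ s2; have [C4 C40 D4] := bound _ s4.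
have [C8 C80 D8] := bound _ s8.
have ks : kappa * s <= s by rewrite ler_piMl// ltW.
have TzM z (b : R) : s / 8 <= b <= s -> cmod z <= r -> nrm (Tz (b%:C + z) x) <= M.
  move=> /andP[sb bs] zr; apply: le_trans (MP _ (in_cone _ _ sb zr) _ _) _.
    apply: le_lt_trans (cmodD _ _) _; rewrite cmod_real ger0_norm; last by lra.
    by move: zr; rewrite /r; lra.
  by rewrite ler_piMr// ltW.
pose u0 (z : R[i]) : X := Tz (s%:C + z) x.
pose u1 (z : R[i]) : X := D (s / 2) (Tz ((s / 2)%:C + z) x).
pose u2 (z : R[i]) : X := D (s / 2) (D (s / 4) (Tz ((s / 4)%:C + z) x)).
pose u3 (z : R[i]) : X := D (s / 2) (D (s / 4) (D (s / 8) (Tz ((s / 8)%:C + z) x))).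
have u1_0 : u1 0 = D (s / 2) (T (s / 2) x) by rewrite /u1 addr0 (ce_real ext s2).
have := @cauchy_estimate R X u0 u1 u2 u3 r M (C2 * (C4 * (C8 * M))) r0.
rewrite u1_0 => H.
have {H} : r * nrm (D (s / 2) (T (s / 2) x)) <= 2 * M.
  apply: H => z zr.
  - have := @cone_extension_derivative id (s / 2) (s / 2) z x (@bounded_op_id _ _) s2.
    rewrite -splitr; apply; apply: in_cone => //; lra.
  - have := @cone_extension_derivative (D (s / 2)) (s / 4) (s / 4) z x (bD _ s2) s4.
    rewrite (_ : s / 4 + s / 4 = s / 2); last by lra.
    by apply; apply: in_cone => //; lra.
  - have := @cone_extension_derivative _ (s / 8) (s / 8) z x
      (bounded_op_comp (bD _ s2) (bD _ s4)) s8.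
    rewrite (_ : s / 8 + s / 8 = s / 4); last by lra.
    by apply; apply: in_cone => //; lra.
  - by apply: TzM => //; apply/andP; split; lra.
  - have tz : nrm (Tz ((s / 8)%:C + z) x) <= M by apply: TzM => //; apply/andP; split; lra.
    apply: le_trans (D2 _) _; rewrite ler_pM2l//.
    apply: le_trans (D4 _) _; rewrite ler_pM2l//.
    by apply: le_trans (D8 _) _; rewrite ler_pM2l.
have -> : 64 * M / kappa / s = 2 * M / r.
  by rewrite /r; field; rewrite !gt_eqF.
by rewrite ler_pdivlMr// mulrC.
Qed.

Lemma analytic_norm_continuous (s e : R) : 0 < s -> 0 < e ->
  exists2 d : R, 0 < d & forall r, 0 < r -> `|r - s| < d ->
    forall x, nrm x <= 1 -> nrm (T r x - T s x) <= e.
Proof.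
move=> s0 e0; have [Dl Dc] := ce_derivative_bounded ext s0.
have [C C0 DC] := (bounded_opP Dl).1 Dc.
have [d d0 dP] := ce_derivative ext s0 ltr01.
have c0 : 0 < 1 + C by lra.
exists (Num.min d (e / (1 + C))) => [|r r0]; first by rewrite lt_min d0 divr_gt0.
rewrite lt_min => /andP[rd rC] x x1; have := dP (r - s)%:C; rewrite cmod_real => /(_ rd x).
rewrite mul1r -rmorphD subrKC !(ce_real ext)// => H1.
rewrite -(subrK ((r - s)%:C *: D s x) (T r x - T s x)).
apply: le_trans (nrmD _ _) _; rewrite nrmZr.
have h1 : `|r - s| * nrm x <= `|r - s| by rewrite ler_piMr.
have h2 : `|r - s| * nrm (D s x) <= `|r - s| * C.
  by rewrite ler_wpM2l// (le_trans (DC _))// ler_piMr// ltW.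
move: rC; rewrite ltr_pdivlMr//; lra.
Qed.

End AnalyticSemigroup.

(** * Comparison of the two semigroups *)

(** A lower bound for the increments of [s `^ p] by its derivative; for [p < 1]
    concavity gives the opposite inequality, hence the error term. *)
Lemma powR_growth (R : realType) (p s e : R) : 0 < s -> 0 < e ->
  exists2 d : R, 0 < d & forall h, 0 < h < d ->
    p * s `^ (p - 1) * h <= (s + h) `^ p - s `^ p + e * h.
Proof.
move=> s0 e0; have [ds dE] := is_derive1_powR p s0.
have : (fun h : R => h^-1 *: ((h *: 1 + s) `^ p - s `^ p)) @ 0^' --> p * s `^ (p - 1).
  by rewrite -dE; exact: ds.
move=> /cvgrPdist_le/(_ _ e0); rewrite /dnbhs /within /= => /nbhs_ballP[d /= d0 dP].
exists d => // h /andP[h0 hd].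
have := dP h; rewrite /ball /= sub0r normrN gtr0_norm// => /(_ hd).
rewrite gt_eqF// => /(_ isT); rewrite ler_norml => /andP[_].
rewrite /GRing.scale /= mulr1 [h + s]addrC => H.
have := ler_wpM2r (ltW h0) H; rewrite mulrBl [h^-1 * _]mulrC divfK ?gt_eqF//; lra.
Qed.

Section Perturbation.
Variables (R : realType) (X : completeNormedModType R[i]).
Variables (A B : operator X) (T S : R -> X -> X) (theta : R).
Hypothesis genA : generates A T.
Hypothesis anT : analytic_semigroup T.
Hypothesis theta01 : 0 <= theta < 1.
Hypothesis subB : subordinate theta B A.
Hypothesis BTcompact : forall t : R, 0 < t -> compact_op (fun x => B (T t x)).
Hypothesis genAB : generates (perturb A B) S.

Let T_C0 : C0_semigroup T := genA.1.
Let S_C0 : C0_semigroup S := genAB.1.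

(** Subordination interpolates between the bound [C / s] of [A (T s x)] and the
    bound of [T s x]. *)
Lemma subordinate_bound : exists2 s0 : R, 0 < s0 & exists2 C : R, 0 < C &
  forall s : R, 0 < s <= s0 -> forall x, nrm x <= 1 -> nrm (B (T s x)) <= C * s `^ (- theta).
Proof.
have /andP[th0 th1] := theta01; have th1' : 0 <= 1 - theta by lra.
have [_ [c c0 Bc]] := subB.
have [kappa [Tz [D ext]]] := analytic_cone_extension anT.
have [s0 s00 [C C0 AC]] := analytic_generator_bound ext genA.
have [M M1 TM] := semigroup_locally_bounded T_C0 s0.
have M0 : 0 < M by lra.
exists s0 => //; exists (c * C `^ theta * M `^ (1 - theta)).
  by rewrite !mulr_gt0// powR_gt0.
move=> s /andP[s_gt0 ss0] x x1.
have [domT _] := analytic_generator ext genA x s_gt0.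
apply: le_trans (Bc _ domT) _.
have h1 : nrm (A (T s x)) `^ theta <= C `^ theta * s `^ (- theta).
  apply: le_trans (_ : (C / s) `^ theta <= _).
    have Cs0 : 0 <= C / s by rewrite divr_ge0// ltW.
    apply: ge0_ler_powR => //; rewrite ?nnegrE ?nrm_ge0//.
    by apply: AC => //; rewrite s_gt0.
  have s_ge0 := ltW s_gt0; have C_ge0 := ltW C0.
  by rewrite powRM ?invr_ge0// -(powR_inv1 s_ge0) -powRrM mulN1r.
have h2 : nrm (T s x) `^ (1 - theta) <= M `^ (1 - theta).
  have M0' := ltW M0; apply: ge0_ler_powR => //; rewrite ?nnegrE ?nrm_ge0//.
  apply: le_trans (TM s _ x) _; first by rewrite ss0 ltW.
  by rewrite ler_piMr.
rewrite -!mulrA ler_pM2l// [M `^ _ * _]mulrC [leRHS]mulrA.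
by apply: ler_pM => //; exact: powR_ge0.
Qed.

Section FixedTime.
Variable t : R.
Hypothesis t0 : 0 < t.

Let f x (s : R) : X := S (t - s) (T s x).
Let G x (s : R) : X := S (t - s) (B (T s x)).

(** With [y := T s x], the increment of [f x] is [S (t - s - h) (T h y - S h y)].
    Analyticity puts [y] in the common domain, where [T h y] and [S h y] have the
    derivatives [A y] and [A y + B y], so [A y] cancels. *)
Lemma duhamel_derivative x (s : R) : 0 < s < t -> right_derivative (f x) s (- G x s).
Proof.
move=> /andP[s0 st] e e0; set y := T s x.
have [kappa [Tz [D ext]]] := analytic_cone_extension anT.
have [domy _] := analytic_generator ext genA x s0; rewrite -/y in domy.
have [M M1 SM] := semigroup_locally_bounded S_C0 t.
have c0 : 0 < 3 * M by lra.
(* one third for each of the derivatives of [T h y] and [S h y], and one for the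
   continuity of [S] at [B y]; each error goes through [S], of norm at most [M] *)
have ec : 0 < e / (3 * M) by rewrite divr_gt0.
have [d1 d10 P1] := (difference_quotientP _ _).1 ((genA.2 y (A y)).1 (conj domy erefl)) _ ec.
have [d2 d20 P2] :=
  (difference_quotientP _ _).1 ((genAB.2 y (A y + B y)).1 (conj domy erefl)) _ ec.
have [d3 d30 P3] := semigroup_cvg0 S_C0 (B y) ec.
exists (Num.min (Num.min d1 d2) (Num.min d3 (t - s))) => [|h].
  by rewrite !lt_min d10 d20 d30 subr_gt0.
rewrite !lt_min => /andP[h0 /andP[/andP[hd1 hd2] /andP[hd3 hts]]].
have hts' : 0 <= t - s - h <= t by apply/andP; split; lra.
have ts0 : 0 <= t - s <= t by apply/andP; split; lra.
have [Sl _] := semigroup_bounded S_C0 (andP hts').1.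
have {P1} := P1 h; rewrite h0 hd1 => /(_ isT) P1.
have {P2} := P2 h; rewrite h0 hd2 => /(_ isT) P2.
have {P3} := P3 h; rewrite (ltW h0) hd3 => /(_ isT) P3.
pose v := T h y - S h y + h%:C *: B y.
have -> : f x (s + h) - f x s - h%:C *: - G x s =
    S (t - s - h) v + h%:C *: (S (t - s) (B y) - S (t - s - h) (B y)).
  rewrite /f /G [s + h]addrC (semigroupD T_C0 x (ltW h0) (ltW s0)) -/y.
  have -> : S (t - s) y = S (t - s - h) (S h y).
    rewrite -(semigroupD S_C0 _ (andP hts').1 (ltW h0)) subrK. by [].
  have -> : t - (h + s) = t - s - h by ring.
  rewrite /v (linear_opD Sl) (linear_opB Sl) (linear_opZ Sl) scalerN opprK scalerBr.
  by rewrite [X in _ = _ + X]addrC addrA addrK.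
apply: le_trans (nrmD _ _) _.
have hv : nrm v <= e / (3 * M) * h + e / (3 * M) * h.
  have -> : v = (T h y - y - h%:C *: A y) - (S h y - y - h%:C *: (A y + B y)).
    rewrite /v scalerDr !opprD !opprK.
    by rewrite [RHS](AC (3*(2*2)) ((1*4*7)*(2*5)*(3*6))) /= !addNr !addr0.
  by apply: le_trans (nrmD _ _) _; rewrite nrmN; lra.
have h1 := le_trans (SM _ hts' v) (ler_wpM2l (le_trans ler01 M1) hv).
have h2 := semigroup_dist S_C0 (B y) SM ts0 hts'.
rewrite opprB subrKC gtr0_norm// in h2.
have h3 := le_trans h2 (ler_wpM2l (le_trans ler01 M1) P3).
rewrite nrmZr gtr0_norm//.
have h4 := ler_wpM2l (ltW h0) h3.
apply: le_trans (lerD h1 h4) _.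
rewrite le_eqVlt; apply/orP; left; apply/eqP; field.
by rewrite gt_eqF//; lra.
Qed.

Lemma duhamel_left_continuous x : left_continuous (f x) 0 t.
Proof.
move=> s /andP[s0 st] e e0; set y := T s x.
have [M M1 SM] := semigroup_locally_bounded S_C0 t.
have [N N1 TN] := semigroup_locally_bounded T_C0 t.
have M0 : 0 < M by lra.
have c1 : 0 < e / (2 * M) by rewrite divr_gt0//; lra.
have N0 : 0 < N by lra.
have c2 : 0 < e / (2 * (M * N)) by rewrite divr_gt0// !mulr_gt0.
have [d1 d10 P1] := semigroup_cvg0 S_C0 y c1.
have [d2 d20 P2] := semigroup_cvg0 T_C0 x c2.
exists (Num.min d1 d2) => [|r /andP[r0 rs]]; first by rewrite lt_min d10.
have rs0 : 0 <= s - r by lra.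
rewrite ltrBlDr -ltrBlDl lt_min => /andP[rd1 rd2].
have ts : 0 <= t - s <= t by apply/andP; split; lra.
have tr : 0 <= t - r <= t by apply/andP; split; lra.
have s_in : 0 <= s <= t by rewrite st ltW.
have r_in : 0 <= r <= t by rewrite r0; lra.
have [Sl _] := semigroup_bounded S_C0 (andP tr).1.
have {}P1 := P1 (s - r); rewrite rs0 rd1 in P1.
have {}P2 := P2 (s - r); rewrite rs0 rd2 in P2.
have h1 := le_trans (semigroup_dist S_C0 y SM ts tr)
  (ler_wpM2l (ltW M0) _).
have h2 := semigroup_dist T_C0 x TN s_in r_in.
rewrite ger0_norm// in h2.
have h3 := ler_wpM2l (le_trans ler01 N1) (P2 isT).
have h4 := le_trans (SM _ tr (T s x - T r x)) (ler_wpM2l (ltW M0) (le_trans h2 h3)).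
have h5 : nrm (S (t - s) y - S (t - r) y) <= M * (e / (2 * M)).
  apply: h1; rewrite (_ : t - s - (t - r) = r - s); last by ring.
  by rewrite distrC ger0_norm//; exact: P1.
apply: le_trans (nrm_tri _ (S (t - r) y) _) _.
rewrite {2}/f -(linear_opB Sl); apply: le_trans (lerD h5 h4) _.
rewrite le_eqVlt; apply/orP; left; apply/eqP; field.
by rewrite !gt_eqF//; lra.
Qed.

Lemma duhamel_right_continuous0 x (e : R) : 0 < e ->
  exists2 d : R, 0 < d & forall a, 0 < a < d -> nrm (f x a - f x 0) <= e.
Proof.
move=> e0; have [M M1 SM] := semigroup_locally_bounded S_C0 t.
have M0 : 0 < M by lra.
have c1 : 0 < e / (2 * M) by rewrite divr_gt0//; lra.
have [d1 d10 P1] := semigroup_cvg0 S_C0 x c1.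
have [d2 d20 P2] := semigroup_cvg0 T_C0 x c1.
exists (Num.min t (Num.min d1 d2)) => [|a]; first by rewrite !lt_min t0 d10.
rewrite !lt_min => /and4P[a0 at_ ad1 ad2].
have ta : 0 <= t - a <= t by apply/andP; split; lra.
have tt : 0 <= t <= t by rewrite lexx ltW.
have [Sl _] := semigroup_bounded S_C0 (andP ta).1.
have {}P1 := P1 a; rewrite (ltW a0) ad1 in P1.
have {}P2 := P2 a; rewrite (ltW a0) ad2 in P2.
have h1 := le_trans (SM _ ta (T a x - x)) (ler_wpM2l (ltW M0) (P2 isT)).
have h2 : nrm (S (t - a) x - S t x) <= M * (e / (2 * M)).
  apply: le_trans (semigroup_dist S_C0 x SM ta tt) _.
  rewrite addrAC subrr sub0r normrN gtr0_norm// ler_pM2l//; exact: P1.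
have -> : f x 0 = S t x by case: T_C0 => _ T0 _ _; rewrite /f subr0 T0.
apply: le_trans (nrm_tri _ (S (t - a) x) _) _.
rewrite {1}/f -(linear_opB Sl); apply: le_trans (lerD h1 h2) _.
rewrite le_eqVlt; apply/orP; left; apply/eqP; field.
by rewrite !gt_eqF//; lra.
Qed.

(** The derivative of [f x] is bounded by a multiple of [s `^ (- theta)], which is
    integrable at 0 as [theta < 1]: [f x] grows at most like
    [g s := K * s `^ (1 - theta)], uniformly on the unit ball. The inequality is
    proved between [a > 0] and [eps], then [a] tends to 0. *)
Lemma duhamel_near0 (e : R) : 0 < e ->
  exists2 eps : R, 0 < eps < t & forall x, nrm x <= 1 -> nrm (f x eps - f x 0) <= e.
Proof.
move=> e0; have /andP[th0 th1] := theta01; have th1' : 0 < 1 - theta by lra.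
have [M M1 SM] := semigroup_locally_bounded S_C0 t.
have M0 : 0 < M by lra.
have [s0 s00 [C C0 BC]] := subordinate_bound.
pose K := M * C / (1 - theta).
have K0 : 0 < K by rewrite divr_gt0// mulr_gt0.
have [d d0 dP] : exists2 d : R, 0 < d & forall h, 0 < h < d -> h `^ (1 - theta) <= e / K.
  apply/near_right0P; have /cvgrPdist_le/(_ (e / K)) := powR_cvg0 th1'.
  rewrite divr_gt0// => /(_ isT); apply: filterS => h.
  by rewrite sub0r normrN ger0_norm ?powR_ge0.
pose eps := Num.min (d / 2) (Num.min s0 (t / 2)).
have eps0 : 0 < eps by rewrite !lt_min s00 !divr_gt0.
have epsd : eps <= d / 2 by rewrite ge_min lexx.
have epss0 : eps <= s0 by rewrite !ge_min lexx orbT.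
have epst : eps <= t / 2 by rewrite !ge_min lexx !orbT.
exists eps; first by rewrite eps0/=; lra.
move=> x x1; apply/ler_addgt0Pr => e' e'0.
have [d' d'0 d'P] := duhamel_right_continuous0 x e'0.
pose a := Num.min eps (d' / 2).
have a0 : 0 < a by rewrite lt_min eps0 divr_gt0.
have aeps : a <= eps by rewrite ge_min lexx.
have ad' : a < d' by rewrite gt_min; apply/orP; right; lra.
have fa0 : nrm (f x a - f x 0) <= e' by apply: d'P; rewrite a0.
pose g (s : R) := K * s `^ (1 - theta).
suff : nrm (f x eps - f x a) <= g eps - g a.
  have : g eps <= e.
    rewrite /g mulrC -ler_pdivlMr//; apply: dP; rewrite eps0/=; lra.
  have : 0 <= g a by rewrite mulr_ge0 ?powR_ge0// ltW.
  have := nrm_tri (f x eps) (f x a) (f x 0); lra.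
apply: mean_value_growth => //.
- move=> s /andP[as_ seps] eta eta0.
  have [|dd dd0 ddP] := @duhamel_left_continuous x s _ eta eta0.
    by apply/andP; split; lra.
  by exists dd => // r /andP[ar rs]; apply: ddP; rewrite rs andbT; lra.
- move=> r s ar rs _; rewrite /g ler_pM2l//.
  by apply: ge0_ler_powR => //; rewrite ?nnegrE; lra.
move=> s /andP[as_ seps] eta eta0.
have s_gt0 : 0 < s by lra.
have st : 0 < s < t by rewrite s_gt0; lra.
have eta2 : 0 < eta / 2 by lra.
have [d1 d10 P1] := duhamel_derivative x st eta2.
have eta2K : 0 < eta / (2 * K) by rewrite divr_gt0// mulr_gt0.
have [d2 d20 P2] := powR_growth (1 - theta) s_gt0 eta2K.
exists (Num.min d1 d2) => [|h]; first by rewrite lt_min d10.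
rewrite lt_min => /and3P[h0 hd1 hd2].
have {}P1 := P1 h; rewrite h0 hd1 in P1.
have {}P2 := P2 h; rewrite h0 hd2 in P2.
have GC : nrm (G x s) <= M * (C * s `^ (- theta)).
  apply: le_trans (SM _ _ _) _; first by apply/andP; split; lra.
  by rewrite ler_pM2l//; apply: BC => //; rewrite s_gt0; lra.
have h1 : nrm (f x (s + h) - f x s) <= eta / 2 * h + h * (M * (C * s `^ (- theta))).
  rewrite -(subrK (h%:C *: - G x s) (f x (s + h) - f x s)).
  apply: le_trans (nrmD _ _) _; apply: lerD; first exact: P1.
  by rewrite nrmZr gtr0_norm// nrmN ler_pM2l.
apply: le_trans h1 _; have := ler_wpM2l (ltW K0) (P2 isT).
have -> : 1 - theta - 1 = - theta by ring.
have -> : K * ((1 - theta) * s `^ (- theta) * h) = h * (M * (C * s `^ (- theta))).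
  by rewrite /K; field; rewrite gt_eqF.
have -> : K * ((s + h) `^ (1 - theta) - s `^ (1 - theta) + eta / (2 * K) * h) =
    g (s + h) - g s + eta / 2 * h.
  by rewrite /g; field; rewrite gt_eqF.
lra.
Qed.

(** [B (T r) = B (T (s / 2)) (T (r - s / 2))] is norm continuous because [T] is so
    at positive times. The variation of [S (t - r)] is applied to the fixed
    totally bounded image of the unit ball under [B (T s)], on which strong
    continuity is uniform. *)
Lemma perturbation_norm_continuous (s e : R) : 0 < s <= t -> 0 < e ->
  exists2 d : R, 0 < d & forall r, 0 < r <= t -> `|r - s| < d ->
    forall x, nrm x <= 1 -> nrm (G x r - G x s) <= e.
Proof.
move=> /andP[s0 st] e0; have [M M1 SM] := semigroup_locally_bounded S_C0 t.
have M0 : 0 < M by lra.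
have s2 : 0 < s / 2 by lra.
have [[BTl BTc] _] := BTcompact s2.
have [C C0 BTC] := (bounded_opP BTl).1 BTc.
have [kappa [Tz [D ext]]] := analytic_cone_extension anT.
have c1 : 0 < e / (2 * (M * C)) by rewrite divr_gt0// !mulr_gt0.
have c2 : 0 < e / (2 * M) by rewrite divr_gt0// mulr_gt0.
have [d1 d10 P1] := analytic_norm_continuous ext s2 c1.
have [_ tBT] := (compact_opP _).1 (BTcompact s0).
have [d2 d20 P2] := semigroup_cvg0_uniform S_C0 tBT c2.
exists (Num.min (s / 2) (Num.min d1 d2)) => [|r /andP[r0 rt]].
  by rewrite !lt_min s2 d10.
rewrite !lt_min => /and3P[rs2 rd1 rd2] x x1.
have rs : 0 < r - s / 2 by move: rs2; rewrite ltr_norml => /andP[]; lra.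
have ts : 0 <= t - s <= t by apply/andP; split; lra.
have tr : 0 <= t - r <= t by apply/andP; split; lra.
have [Sl _] := semigroup_bounded S_C0 (andP tr).1.
have h1 : nrm (B (T r x) - B (T s x)) <= C * (e / (2 * (M * C))).
  have -> : T r x = T (s / 2) (T (r - s / 2) x).
    by rewrite -(semigroupD T_C0 x (ltW s2) (ltW rs)); congr T; lra.
  have -> : T s x = T (s / 2) (T (s / 2) x).
    by rewrite -(semigroupD T_C0 x (ltW s2) (ltW s2)) -splitr.
  rewrite -(linear_opB BTl); apply: le_trans (BTC _) _; rewrite ler_pM2l//.
  apply: P1 => //; rewrite (_ : r - s / 2 - s / 2 = r - s)//; lra.
have h2 : nrm (S (t - r) (B (T s x)) - S (t - s) (B (T s x))) <= M * (e / (2 * M)).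
  apply: le_trans (semigroup_dist S_C0 _ SM tr ts) _; rewrite ler_pM2l//.
  rewrite (_ : t - r - (t - s) = s - r); last by ring.
  by apply: P2; [rewrite normr_ge0 distrC | exists x].
apply: le_trans (nrm_tri _ (S (t - r) (B (T s x))) _) _.
rewrite {1}/G -(linear_opB Sl).
apply: le_trans (lerD (le_trans (SM _ tr _) (ler_wpM2l (ltW M0) h1)) h2) _.
rewrite le_eqVlt; apply/orP; left; apply/eqP; field.
by rewrite !gt_eqF.
Qed.

(** [f x r + r *: G x s] has a derivative of norm at most [e] near [s]. *)
Lemma duhamel_increment (s e : R) : 0 < s <= t -> 0 < e ->
  exists2 d : R, 0 < d & forall a b, 0 < a -> a <= b -> b <= t ->
    `|a - s| < d -> `|b - s| < d -> forall x, nrm x <= 1 ->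
    nrm (f x b - f x a + (b - a)%:C *: G x s) <= e * (b - a).
Proof.
move=> s_in e0; have [d d0 dP] := perturbation_norm_continuous s_in e0.
exists d => // a b a0 ab bt ad bd x x1.
pose g (r : R) := f x r + r%:C *: G x s.
have -> : f x b - f x a + (b - a)%:C *: G x s = g b - g a.
  by rewrite /g rmorphB /= scalerBl opprD addrACA.
apply: (mean_value_bound (f' := fun r => - G x r + G x s)) => //.
  move=> r /andP[ar rb] eta eta0; have eta2 : 0 < eta / 2 by lra.
  have [|d1 d10 P1] := @duhamel_left_continuous x r _ _ eta2.
    by apply/andP; split; lra.
  have [d2 d20 P2] := real_derivative_left_continuous
    (fun u _ => real_derivative_line (G x s) u) (introT andP (conj ar rb)) eta2.
  exists (Num.min d1 d2) => [|u /andP[au ur]]; first by rewrite lt_min d10.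
  rewrite ltrBlDr -ltrBlDl lt_min => /andP[ud1 ud2].
  rewrite /g opprD addrACA; apply: le_trans (nrmD _ _) _; rewrite [eta]splitr.
  apply: lerD; first by apply: P1; [rewrite ur; lra | lra].
  by apply: P2; [rewrite au | lra].
move=> r /andP[ar rb]; split.
  move=> eta eta0; have [|d1 d10 P1] := @duhamel_derivative x r _ eta eta0.
    by apply/andP; split; lra.
  exists d1 => // h /P1; rewrite /g scalerDr rmorphD /= scalerDl !opprD.
  rewrite [in X in _ -> X](AC (((1*2)*2)*2) ((1*4*6)*(2*5)*(3*7))) /=.
  by rewrite !subrr !addr0.
rewrite [X in nrm X]addrC nrmC; apply: dP => //.
  by rewrite (lt_le_trans a0 ar) (le_trans (ltW rb)).
have := ler_norm (a - s); move: ad bd; rewrite !ltr_norml => /andP[? ?] /andP[? ?] _.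
by apply/andP; split; lra.
Qed.

(** By real induction on the right end of the interval: near each [s] the increment
    of [f] is within [e] times its length of a multiple of the compact operator
    [x |-> G x s]. The resulting [K] is a Riemann sum. *)
Lemma duhamel_compact (eps e : R) : 0 < eps < t -> 0 < e ->
  exists2 K, compact_op K &
    forall x, nrm x <= 1 -> nrm (f x t - f x eps - K x) <= e * (t - eps).
Proof.
move=> /andP[eps0 epst] e0.
have cG (s : R) : 0 < s <= t -> compact_op (fun x => G x s).
  move=> /andP[s0 st]; apply: (@compact_op_comp _ _ (S (t - s)) (fun x => B (T s x))).
    by apply: semigroup_bounded => //; rewrite subr_ge0.
  exact: BTcompact.
pose P (s : R) := exists2 K, compact_op K &
  forall x, nrm x <= 1 -> nrm (f x s - f x eps - K x) <= e * (s - eps).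
have increment (a b s : R) : 0 < s <= t -> P a ->
    (forall x, nrm x <= 1 -> nrm (f x b - f x a + (b - a)%:C *: G x s) <= e * (b - a)) ->
    P b.
  move=> s_in [K cK KP] ab.
  exists (fun x => K x + (- (b - a)%:C) *: G x s).
    by apply: compact_opD cK _; apply: compact_op_scale; exact: cG.
  move=> x x1; have := ab x x1; have := KP x x1; rewrite scaleNr.
  have -> : f x b - f x eps - (K x - (b - a)%:C *: G x s) =
     (f x b - f x a + (b - a)%:C *: G x s) + (f x a - f x eps - K x).
    by rewrite opprB [RHS](AC (3*3) ((1*5)*(3*6)*(2*4))) /= addNr addr0.
  by move=> h1 h2; apply: le_trans (nrmD _ _) _; lra.
apply: (@real_induction _ P eps t (ltW epst)).
- exists (fun=> 0); first exact: compact_op0.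
  by move=> x _; rewrite !subrr nrm0 mulr0.
- move=> s /andP[es st] Ps; have s_in : 0 < s <= t by apply/andP; split; lra.
  have [d d0 dP] := duhamel_increment s_in e0.
  exists d => // r /andP[sr rd] rt; apply: increment s_in Ps _ => x x1.
  apply: dP => //; rewrite ?subrr ?normr0//; try lra.
  by rewrite gtr0_norm; lra.
move=> s /andP[es st] Pr; have s_in : 0 < s <= t by apply/andP; split; lra.
have [d d0 dP] := duhamel_increment s_in e0.
pose r := Num.max eps (s - d / 2).
have er : eps <= r by rewrite le_max lexx.
have rs : r < s by rewrite gt_max es/=; lra.
have rd : s - d / 2 <= r by rewrite le_max lexx orbT.
apply: increment s_in (Pr r _) _; first by rewrite er.
move=> x x1; apply: dP => //; rewrite ?subrr ?normr0//; try lra.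
by rewrite ltr0_norm; lra.
Qed.

(** [S t x - T t x = f x 0 - f x t] is the sum of an increment that is small in
    norm, between 0 and [eps], and of one close to a compact operator, between [eps]
    and [t]. *)
Lemma semigroup_difference_compact : compact_op (fun x => S t x - T t x).
Proof.
have bS := semigroup_bounded S_C0 (ltW t0); have bT := semigroup_bounded T_C0 (ltW t0).
apply: compact_op_limit.
  have := bounded_opD bS (bounded_op_comp (bounded_op_scale X (-1)) bT).
  by under eq_fun do rewrite scaleN1r.
move=> e e0; have e2 : 0 < e / 2 by lra.
have [eps eps_in near0] := duhamel_near0 e2.
have et : 0 < e / (2 * t) by rewrite divr_gt0// mulr_gt0.
have [K cK KP] := duhamel_compact eps_in et; have /andP[eps0 epst] := eps_in.
exists (fun x => -1 *: K x); first exact: compact_op_scale.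
move=> x x1; rewrite scaleN1r.
have f0 : f x 0 = S t x by case: T_C0 => _ T0 _ _; rewrite /f subr0 T0.
have ft : f x t = T t x by case: S_C0 => _ S0 _ _; rewrite /f subrr S0.
have -> : S t x - T t x - - K x = - (f x eps - f x 0) - (f x t - f x eps - K x).
  rewrite f0 ft opprB !opprD !opprK.
  by rewrite [RHS](AC (2*3) ((1*3*5)*(2*4))) /= addNr addr0.
apply: le_trans (nrmD _ _) _; rewrite !nrmN.
have := near0 x x1; have := KP x x1.
have : e / (2 * t) * (t - eps) <= e / 2.
  rewrite [leRHS](_ : e / 2 = e / (2 * t) * t); last by field; rewrite gt_eqF.
  by rewrite ler_pM2l//; lra.
lra.
Qed.

End FixedTime.
End Perturbation.

(** * Quasi-compactness *)

Theorem lemma1 (R : realType) (X : completeNormedModType R[i])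
  (A B : operator X) (T S : R -> X -> X) (theta : R)
  (genA : generates A T)
  (qcT : quasi_compact T)
  (anT : analytic_semigroup T)
  (linB : linear_operator B)
  (theta01 : 0 <= theta < 1)
  (subB : subordinate theta B A)
  (BTcompact : forall t : R, 0 < t -> compact_op (fun x => B (T t x)))
  (genAB : generates (perturb A B) S) :
  quasi_compact S.
Proof.
have diff t : 0 < t -> compact_op (fun x => S t x - T t x).
  exact: semigroup_difference_compact genA anT theta01 subB BTcompact genAB t.
apply: cvg_trans qcT; apply: near_eq_cvg; near=> t.
have t0 : 0 < t by near: t; exact: nbhs_pinfty_gt.
(* [K |-> K + (S t - T t)] permutes the compact operators, so [S t] and [T t] are
   at the same distance from them *)
congr ereal_inf; apply/seteqP; split=> _ [K cK <-].
  exists (fun x => K x + (S t x - T t x)); first exact: compact_opD cK (diff t t0).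
  congr opnorm; apply/funext => x.
  by rewrite opprD opprB addrCA subrKC addrC.
exists (fun x => K x + -1 *: (S t x - T t x)).
  by apply: compact_opD cK _; apply: compact_op_scale; exact: diff.
congr opnorm; apply/funext => x.
by rewrite scaleN1r opprD opprK addrCA subrKC addrC.
Unshelve. all: by end_near. Qed.
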